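(* Let $(t_n)_{n\in\mathbb N}$ be positive numbers with $1=t_1>t_2>t_3>\dots$, $\lim_{n\to\infty}t_n=0$ and $\lim_{n\to\infty}t_{n+1}/t_n=0$, and let $(\zeta_n)_{n\in\mathbb N}$ be points of $\overline{\mathbb C_+}$ with $\lim_{n\to\infty}\chi(\zeta_{n+1},\zeta_n)=0$. Define the Hamiltonian $H\in\mathbb H$ by $H(t)=\Theta(\zeta_n)$ for $t\in(t_{n+1},t_n]$, $n\in\mathbb N$, and $H(t)=\Theta(0)$ for $t\in(1,\infty)$. Then for every $M\subseteq\mathbb C_+$ satisfying ( * ), $$\operatorname{Ca}(q_H)=\operatorname{CL}(q_H,M)=\operatorname{Cl}(\zeta_n),$$ where $\operatorname{Cl}(\zeta_n)=\{\zeta\in\overline{\mathbb C_+}:\exists n_k\to\infty,\ \zeta_{n_k}\to\zeta\}$.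
   Context: $\overline{\mathbb C_+}=\mathbb C_+\cup\mathbb R\cup\{\infty\}$ in the Riemann sphere, with chordal metric $\chi(\zeta,\xi)=\frac{2|\zeta-\xi|}{\sqrt{1+|\zeta|^2}\sqrt{1+|\xi|^2}}$. $\mathbb H$ is the set of measurable $H:(0,\infty)\to\mathbb R^{2\times2}$ with $H(t)\ge0$, $\operatorname{tr}H(t)=1$ a.e. $\Theta(\zeta)$ denotes the constant matrix $\frac{1}{|\zeta|^2+1}\begin{pmatrix}|\zeta|^2&\operatorname{Re}\zeta\\\operatorname{Re}\zeta&1\end{pmatrix}$ for $\zeta\neq\infty$ and $\Theta(\infty)=\begin{pmatrix}1&0\\0&0\end{pmatrix}$. With $J=\begin{pmatrix}0&-1\\1&0\end{pmatrix}$ and $W(H;t,z)=(w_{ij})$ the solution of $\partial_tW(H;t,z)J=zW(H;t,z)H(t)$, $W(H;0,z)=I$, the Weyl coefficient is $q_H(z)=\lim_{t\to\infty}w_{12}(H;t,z)/w_{22}(H;t,z)$ (chordal limit), $z\in\mathbb C_+$. For $\alpha\in(0,\pi/2]$, $\Gamma_\alpha=\{z\in\mathbb C_+:\arg z\in[\alpha,\pi-\alpha]\}$. For $M\subseteq\mathbb C_+$, $\operatorname{CL}(q,M)=\{\zeta\in\overline{\mathbb C}:\exists z_n\in M,|z_n|\to\infty,q(z_n)\to\zeta\}$; $\operatorname{Ca}(q)=\bigcup_{\alpha\in(0,\pi/2]}\operatorname{CL}(q,\Gamma_\alpha)$. Condition ( * ) on $M\subseteq\mathbb C_+$: $M$ unbounded,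 $M\subseteq\Gamma_\alpha$ for some $\alpha\in(0,\pi/2]$, and $\{z\in M:|z|\ge r\}$ connected for all sufficiently large $r$. *)

(* Defs.v *)
From HB Require Import structures.
From mathcomp Require Import all_boot all_order all_algebra.
From mathcomp Require Import all_classical all_reals all_analysis.
From mathcomp Require Import complex.
Set Implicit Arguments. Unset Strict Implicit. Unset Printing Implicit Defensive.
Import Order.TTheory GRing.Theory Num.Theory.
Import numFieldNormedType.Exports.
Local Open Scope classical_set_scope.
Local Open Scope ring_scope.
Local Open Scope complex_scope.

Section Defs.
Variable R : realType.

Definition cre (z : R[i]) : R := complex.Re z.
Definition cim (z : R[i]) : R := complex.Im z.

Definition cabs (z : R[i]) : R := Num.sqrt (cre z ^+ 2 + cim z ^+ 2).

(* Riemann sphere: None = infinity *)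
Definition chi (a b : option R[i]) : R :=
  match a, b with
  | Some x, Some y => 2 * cabs (x - y) / (Num.sqrt (1 + cabs x ^+ 2) * Num.sqrt (1 + cabs y ^+ 2))
  | Some x, None | None, Some x => 2 / Num.sqrt (1 + cabs x ^+ 2)
  | None, None => 0
  end.

Definition sph_ratio (a b : R[i]) : option R[i] := if b == 0 then None else Some (a / b).

Definition mx2 (T : Type) (a b c d : T) : 'M[T]_2 :=
  \matrix_(i < 2, j < 2)
    if (val i == 0)%N then (if (val j == 0)%N then a else b)
    else (if (val j == 0)%N then c else d).

Definition Theta (zeta : option R[i]) : 'M[R]_2 :=
  match zeta with
  | Some x => (cabs x ^+ 2 + 1)^-1 *: mx2 (cabs x ^+ 2) (cre x) (cre x) 1
  | None => mx2 1 0 0 0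
  end.

Definition Jmx : 'M[R[i]]_2 := mx2 0 (-1) 1 0.

Definition mu := @lebesgue_measure R.

Definition cintegrable (f : R -> R[i]) (a b : R) : Prop :=
  mu.-integrable `[a, b] (fun s => (cre (f s))%:E) /\
  mu.-integrable `[a, b] (fun s => (cim (f s))%:E).

Definition cRint (f : R -> R[i]) (a b : R) : R[i] :=
  (Rintegral mu `[a, b] (fun s => cre (f s))) +i* (Rintegral mu `[a, b] (fun s => cim (f s))).

Definition complexify (A : 'M[R]_2) : 'M[R[i]]_2 := map_mx (fun x => x%:C) A.

Definition is_fund_sol (H : R -> 'M[R]_2) (z : R[i]) (W : R -> 'M[R[i]]_2) : Prop :=
  W 0 = 1%:M /\
  forall t, 0 <= t ->
    (forall i j, cintegrable (fun s => (W s *m complexify (H s)) i j) 0 t) /\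
    W t *m Jmx = Jmx + z *: \matrix_(i, j) cRint (fun s => (W s *m complexify (H s)) i j) 0 t.

Definition chordal_lim_infty (f : R -> option R[i]) (l : option R[i]) : Prop :=
  forall e : R, 0 < e -> exists T : R, forall s, T < s -> chi (f s) l < e.

Definition i0 : 'I_2 := @Ordinal 2 0 isT.
Definition i1 : 'I_2 := @Ordinal 2 1 isT.

Definition Cplus : set R[i] := [set z | 0 < cim z].
Definition in_closed_Cplus (zeta : option R[i]) : Prop :=
  match zeta with Some x => 0 <= cim x | None => True end.

Definition carg (z : R[i]) : R := acos (cre z / cabs z).

Definition Gamma (alpha : R) : set R[i] :=
  [set z | 0 < cim z /\ alpha <= carg z <= pi - alpha].

Definition CL (q : R[i] -> option R[i]) (M : set R[i]) : set (option R[i]) :=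
  [set l | exists zs : nat -> R[i], (forall n, M (zs n)) /\
     (cabs (zs n) @[n --> \oo] --> +oo) /\ (chi (q (zs n)) l @[n --> \oo] --> 0)].

Definition Ca (q : R[i] -> option R[i]) : set (option R[i]) :=
  [set l | exists alpha : R, 0 < alpha <= pi / 2 /\ CL q (Gamma alpha) l].

Definition toR2 (z : R[i]) : R * R := (cre z, cim z).

Definition cond_star (M : set R[i]) : Prop :=
  (forall r : R, exists z, M z /\ r < cabs z) /\
  (exists alpha : R, 0 < alpha <= pi / 2 /\ M `<=` Gamma alpha) /\
  (exists r0 : R, forall r, r0 <= r -> connected (toR2 @` [set z | M z /\ r <= cabs z])).

Definition Clus (zeta : nat -> option R[i]) : set (option R[i]) :=
  [set l | in_closed_Cplus l /\ exists nk : nat -> nat,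
     (forall N, exists K, forall k, (K <= k)%N -> (N <= nk k)%N) /\
     (chi (zeta (nk k)) l @[k --> \oo] --> 0)].

End Defs.

(* Main.v *)
Require Import Defs.
From HB Require Import structures.
From mathcomp Require Import all_boot all_order all_algebra.
From mathcomp Require Import all_classical all_reals all_analysis.
From mathcomp Require Import complex ring lra.
Import Order.TTheory GRing.Theory Num.Theory.
Import numFieldNormedType.Exports.
Local Open Scope classical_set_scope.
Local Open Scope ring_scope.
Set Implicit Arguments. Unset Strict Implicit. Unset Printing Implicit Defensive.

(** For [z] in a fixed sector with [t (n+1) < 1/|z| <= t n], the Hamiltonian is within [o(1)]
    of the constant [Theta (zeta n)] on a window [[t (n+2), L/|z|]], where [L] is large and
    [t (n+2) |z|] is small, and [q z] is shown to be close to [zeta n].  Let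
    [q_s = w12(s) / w22(s)] and let [y] be the row solution [v W] with [v = (w22(s), - w12(s))],
    so that the second entry of [y] vanishes at [s].  The form [F = 2 Im (y2 conj(y1))] is
    nondecreasing with [F s = 0] and [F 0 >= - |v|^2].  For a constant Hamiltonian
    [Theta zeta], the function [G = 2 |y1 zeta + y2|^2 / (1 + |zeta|^2)] is nondecreasing and
    [F' >= (Im z) G] as long as [F <= 0]; hence [G 0 * Im z * L/|z| <= |v|^2], while
    [G 0 = |v|^2 chi(q_s, zeta)^2 / 2].  Both monotonicity statements survive perturbation of
    the Hamiltonian, uniformly in [zeta].

    Quadratic expressions in [y] are handled through the Bloch vector
    [S = |y1|^2 + |y2|^2], [D = |y1|^2 - |y2|^2], [C = 2 Re (y1 conj(y2))], [F], and [zeta] through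
    its stereographic projection, in which [chi] is the Euclidean distance of [R^3] and
    [Theta zeta] is affine.

    Given the window estimate, cluster points of [q] in a sector are cluster points of [zeta];
    conversely a set satisfying the connectedness condition meets every large circle, so
    points with [|z| = 1/t n] can be chosen in it. *)

(** * Calculus on the half-line with countably many exceptional points *)

Section Calculus.
Variable R : realType.
Implicit Types (f g : R -> R) (a b s : R).

(** Only a limit from the right is asked at 0, because the integral equation says nothing about
    negative arguments. *)
Definition continuous_ge0 f :=
  (forall s, 0 < s -> {for s, continuous f}) /\ f x @[x --> 0^'+] --> f 0.

Lemma continuous_ge0_cst a : continuous_ge0 (fun=> a).
Proof. by split=> [s _|]; [exact: cvg_cst|exact: cvg_cst]. Qed.

Lemma continuous_ge0D f g :
  continuous_ge0 f -> continuous_ge0 g -> continuous_ge0 (fun s => f s + g s).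
Proof.
by move=> [fc f0] [gc g0]; split=> [s s0|]; apply: cvgD => //; [exact: fc|exact: gc].
Qed.

Lemma continuous_ge0M f g :
  continuous_ge0 f -> continuous_ge0 g -> continuous_ge0 (fun s => f s * g s).
Proof.
by move=> [fc f0] [gc g0]; split=> [s s0|]; apply: cvgM => //; [exact: fc|exact: gc].
Qed.

Lemma continuous_ge0N f : continuous_ge0 f -> continuous_ge0 (fun s => - f s).
Proof. by move=> [fc f0]; split=> [s s0|]; apply: cvgN => //; exact: fc. Qed.

Lemma continuous_ge0B f g :
  continuous_ge0 f -> continuous_ge0 g -> continuous_ge0 (fun s => f s - g s).
Proof. by move=> fc /continuous_ge0N; exact: continuous_ge0D. Qed.

Lemma continuous_ge0_id : continuous_ge0 id.
Proof.
split=> [s _|]; first exact: cvg_id.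
by apply: cvg_at_right_filter; exact: cvg_id.
Qed.

Lemma continuous_ge0_itv f a b : 0 <= a -> a < b ->
  continuous_ge0 f -> {within `[a, b], continuous f}.
Proof.
move=> a0 ab [fc f0]; apply/continuous_within_itvP => //; split.
- by move=> x /[!in_itv]/= /andP[ax _]; apply: fc; exact: le_lt_trans ax.
- move: a0; rewrite le_eqVlt => /predU1P[<-//|a0].
  by apply: cvg_at_right_filter; exact: fc.
- by apply: cvg_at_left_filter; apply: fc; exact: le_lt_trans ab.
Qed.

Definition integral_from0 f s := (\int[@mu R]_(x in `[0%R, s]) f x)%R.

Lemma continuous_ge0_integral_from0 f :
  (forall s, 0 <= s -> (@mu R).-integrable `[0%R, s] (EFin \o f)) ->
  continuous_ge0 (integral_from0 f).
Proof.
move=> fi.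
have cw b : 0 < b -> [/\ {in `]0%R, b[, continuous (integral_from0 f)},
   integral_from0 f x @[x --> 0^'+] --> integral_from0 f 0 &
   integral_from0 f x @[x --> b^'-] --> integral_from0 f b].
  move=> b0; apply/continuous_within_itvP => //.
  by apply: parameterized_integral_continuous (ltW b0) _; exact/fi/ltW.
split=> [s s0|]; last by have [] := cw 1 ltr01.
have [|+ _ _] := cw (s + 1); first by rewrite addr_gt0.
by apply; rewrite in_itv/= s0 ltrDl ltr01.
Qed.

Lemma is_derive_integral_from0 f s : 0 < s ->
  (forall s, 0 <= s -> (@mu R).-integrable `[0%R, s] (EFin \o f)) ->
  {for s, continuous f} -> is_derive s 1 (integral_from0 f) (f s).
Proof.
move=> s0 fi fc.
have [] := @continuous_FTC1 R f (BLeft 0) s (s + 1) _ _ _ fc.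
- by rewrite ltrDl.
- by apply: fi; rewrite addr_ge0// ltW.
- by rewrite lte_fin.
by move=> d e; apply: DeriveDef => //; rewrite -derive1E.
Qed.

Lemma is_derive1D f g s df dg : is_derive s 1 f df -> is_derive s 1 g dg ->
  is_derive s 1 (fun x => f x + g x) (df + dg).
Proof. by move=> Df Dg; exact: (@is_deriveD _ _ _ f g). Qed.

Lemma is_derive1N f s df : is_derive s 1 f df ->
  is_derive s 1 (fun x => - f x) (- df).
Proof. by move=> Df; exact: (@is_deriveN _ _ _ f). Qed.

Lemma is_derive1B f g s df dg : is_derive s 1 f df -> is_derive s 1 g dg ->
  is_derive s 1 (fun x => f x - g x) (df - dg).
Proof. by move=> Df /is_derive1N; exact: is_derive1D. Qed.

Lemma is_derive1M f g s df dg : is_derive s 1 f df -> is_derive s 1 g dg ->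
  is_derive s 1 (fun x => f x * g x) (f s * dg + g s * df).
Proof. by move=> Df Dg; exact: (@is_deriveM _ _ f g). Qed.

Lemma is_derive1Z f s c df : is_derive s 1 f df ->
  is_derive s 1 (fun x => c * f x) (c * df).
Proof. by move=> Df; exact: (@is_deriveZ _ _ _ f). Qed.

Lemma is_derive1Dcst f s c df : is_derive s 1 f df ->
  is_derive s 1 (fun x => c + f x) df.
Proof.
by move=> Df; rewrite -[df]add0r; apply: is_derive1D => //.
Qed.

(** Induction on the list: an exceptional point inside the interval splits it in two, and one
    outside is discarded. *)
Lemma le_finite_exceptions f (l : seq R) a b : a <= b ->
  {within `[a, b], continuous f} ->
  (forall s, a < s < b -> s \notin l -> exists2 f', is_derive s 1 f f' & 0 <= f') ->
  f a <= f b.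
Proof.
elim: l a b => [|x l IH] a b.
  rewrite le_eqVlt => /predU1P[-> //|ab fc fd].
  apply: (@ger0_derive1_le_cc _ f a b) => //; last exact: ltW.
  - by move=> s; rewrite in_itv/= => /fd[]// f' [].
  - by move=> s; rewrite in_itv/= => /fd[]// f' [? <-]; rewrite derive1E.
  - by rewrite bound_itvE ltW.
  - by rewrite bound_itvE ltW.
move=> ab fc fd.
have [/andP[ax xb]|xab] := boolP (a < x < b); last first.
  apply: IH => // s sab sl; apply: fd => //; rewrite inE negb_or sl andbT.
  by apply: contraNneq xab => <-.
apply: (@le_trans _ _ (f x)); apply: IH.
- exact: ltW.
- by apply: continuous_subspaceW fc; apply: subset_itvl; rewrite bnd_simp ltW.
- move=> s /andP[as_ sx] sl; apply: fd; first by rewrite as_ (lt_trans sx).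
  by rewrite inE negb_or sl lt_eqF.
- exact: ltW.
- by apply: continuous_subspaceW fc; apply: subset_itvr; rewrite bnd_simp ltW.
- move=> s /andP[xs sb] sl; apply: fd; first by rewrite sb (lt_trans ax).
  by rewrite inE negb_or sl gt_eqF.
Qed.

(** To the right of a positive point there are only finitely many [t k]; the case [a = 0] follows by
    a limit from the right. All monotonicity arguments below rest on this, since the jumps of the
    Hamiltonian accumulate at 0. *)
Lemma le_null_seq_exceptions f (t : nat -> R) a b : t n @[n --> \oo] --> (0 : R) ->
  0 <= a -> a <= b -> continuous_ge0 f ->
  (forall s, a < s < b -> (forall k, s != t k) ->
     exists2 f', is_derive s 1 f f' & 0 <= f') ->
  f a <= f b.
Proof.
move=> t0 a0 ab fc fd.
have pos a' : a <= a' -> 0 < a' -> a' <= b -> f a' <= f b.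
  move=> aa' a'0; rewrite le_eqVlt => /predU1P[-> //|a'b].
  have [N _ tN] : \forall k \near \oo, t k < a' by exact: (cvgr_lt _ t0).
  apply: (@le_finite_exceptions _ [seq t k | k <- iota 0 N]); first exact: ltW.
    by apply: continuous_ge0_itv => //; exact: ltW.
  move=> s /andP[a's sb] sl; apply: fd; first by rewrite (le_lt_trans aa').
  move=> k; apply: contra sl => /eqP sk; apply/mapP; exists k => //.
  rewrite mem_iota leq0n add0n /=; rewrite ltnNge; apply/negP => /tN.
  by rewrite -sk => /(lt_trans a's); rewrite ltxx.
move: (a0) (ab); rewrite le_eqVlt => /predU1P[aE|a'0]; last by move=> ?; exact: pos.
rewrite le_eqVlt => /predU1P[-> //|ab'].
rewrite -aE; have [_ f0] := fc.
rewrite -(cvg_lim _ f0)//; apply: limr_le.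
  by apply: cvgP f0.
near=> x; apply: pos.
- by rewrite -aE; near: x; exact: nbhs_right_ge.
- by near: x; exact: nbhs_right_gt.
- by near: x; apply: nbhs_right_le; rewrite aE.
Unshelve. all: by end_near. Qed.

End Calculus.

(** * Rows of the fundamental solution *)

Section FundamentalSolution.
Variable R : realType.
Local Open Scope complex_scope.

Lemma mx2_00 T (a b c d : T) : mx2 a b c d i0 i0 = a. Proof. by rewrite mxE. Qed.
Lemma mx2_01 T (a b c d : T) : mx2 a b c d i0 i1 = b. Proof. by rewrite mxE. Qed.
Lemma mx2_10 T (a b c d : T) : mx2 a b c d i1 i0 = c. Proof. by rewrite mxE. Qed.
Lemma mx2_11 T (a b c d : T) : mx2 a b c d i1 i1 = d. Proof. by rewrite mxE. Qed.
Definition mx2E := (mx2_00, mx2_01, mx2_10, mx2_11).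

Lemma mulmx2E (A : pzRingType) (M N : 'M[A]_2) i j :
  (M *m N) i j = M i i0 * N i0 j + M i i1 * N i1 j.
Proof.
rewrite mxE big_ord_recl big_ord1; congr (M i _ * N _ j + M i _ * N _ j);
  exact/val_inj.
Qed.

(* The row [y = (u1 + i u2, u3 + i u4)] solves [y' = - z y H J], [z = sg + i ta],
   at every [s] near which [H] is constant. *)
Definition row_solution (H : R -> 'M[R]_2) (sg ta : R) (u1 u2 u3 u4 : R -> R) :=
  [/\ continuous_ge0 u1, continuous_ge0 u2, continuous_ge0 u3, continuous_ge0 u4 &
  forall s : R, 0 < s -> (\forall r \near s, H r = H s) ->
  let h := H s in
  [/\ is_derive s 1 u1 (- (sg * (u1 s * h i0 i1 + u3 s * h i1 i1)
                          - ta * (u2 s * h i0 i1 + u4 s * h i1 i1))),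
      is_derive s 1 u2 (- (sg * (u2 s * h i0 i1 + u4 s * h i1 i1)
                          + ta * (u1 s * h i0 i1 + u3 s * h i1 i1))),
      is_derive s 1 u3 (sg * (u1 s * h i0 i0 + u3 s * h i1 i0)
                       - ta * (u2 s * h i0 i0 + u4 s * h i1 i0)) &
      is_derive s 1 u4 (sg * (u2 s * h i0 i0 + u4 s * h i1 i0)
                       + ta * (u1 s * h i0 i0 + u3 s * h i1 i0))]].

Definition re_entry (W : R -> 'M[R[i]]_2) (i j : 'I_2) (s : R) := cre (W s i j).
Definition im_entry (W : R -> 'M[R[i]]_2) (i j : 'I_2) (s : R) := cim (W s i j).

Lemma creD (x y : R[i]) : cre (x + y) = cre x + cre y. Proof. by case: x; case: y. Qed.
Lemma cimD (x y : R[i]) : cim (x + y) = cim x + cim y. Proof. by case: x; case: y. Qed.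
Lemma creN (x : R[i]) : cre (- x) = - cre x. Proof. by case: x. Qed.
Lemma cimN (x : R[i]) : cim (- x) = - cim x. Proof. by case: x. Qed.
Lemma creM (x y : R[i]) : cre (x * y) = cre x * cre y - cim x * cim y.
Proof. by case: x; case: y. Qed.
Lemma cimM (x y : R[i]) : cim (x * y) = cre x * cim y + cim x * cre y.
Proof. by case: x => ? ?; case: y. Qed.

Lemma cre_mul_complexify (V : 'M[R[i]]_2) (h : 'M[R]_2) i j :
  cre ((V *m complexify h) i j) = cre (V i i0) * h i0 j + cre (V i i1) * h i1 j.
Proof. by rewrite mulmx2E !mxE creD !creM /= !mulr0 !subr0. Qed.

Lemma cim_mul_complexify (V : 'M[R[i]]_2) (h : 'M[R]_2) i j :
  cim ((V *m complexify h) i j) = cim (V i i0) * h i0 j + cim (V i i1) * h i1 j.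
Proof. by rewrite mulmx2E !mxE cimD !cimM /= !mulr0 !add0r. Qed.

(** Right multiplication by [J] swaps the columns up to sign, so the integral equation makes each
    entry an affine function of integrals. These are continuous, and differentiable wherever [H] is
    locally constant. *)
Lemma fund_sol_row (H : R -> 'M[R]_2) z W i : is_fund_sol H z W ->
  row_solution H (cre z) (cim z) (re_entry W i i0) (im_entry W i i0)
    (re_entry W i i1) (im_entry W i i1).
Proof.
move=> [_ sol].
pose fr j s := cre ((W s *m complexify (H s)) i j).
pose fi j s := cim ((W s *m complexify (H s)) i j).
have fr_int j s : 0 <= s -> (@mu R).-integrable `[0%R, s] (EFin \o fr j).
  by move=> /sol[/(_ i j)[]].
have fi_int j s : 0 <= s -> (@mu R).-integrable `[0%R, s] (EFin \o fi j).
  by move=> /sol[/(_ i j)[]].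
have cr j := continuous_ge0_integral_from0 (fr_int j).
have ci j := continuous_ge0_integral_from0 (fi_int j).
have WE j s : 0 <= s -> (W s *m Jmx R) i j = Jmx R i j
    + z * (integral_from0 (fr j) s +i* integral_from0 (fi j) s).
  by move=> /sol[_ ->]; rewrite !mxE.
have W1 s : 0 <= s -> W s i i1 = Jmx R i i0
    + z * (integral_from0 (fr i0) s +i* integral_from0 (fi i0) s).
  by move=> /(WE i0) <-; rewrite mulmx2E !mx2E mulr0 mulr1 add0r.
have W0 s : 0 <= s -> W s i i0 = - (Jmx R i i1
    + z * (integral_from0 (fr i1) s +i* integral_from0 (fi i1) s)).
  by move=> /(WE i1) <-; rewrite mulmx2E !mx2E mulr0 mulrN1 addr0 opprK.
pose v1 s := - (cre (Jmx R i i1) + (cre z * integral_from0 (fr i1) s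
  - cim z * integral_from0 (fi i1) s)).
pose v2 s := - (cim (Jmx R i i1) + (cre z * integral_from0 (fi i1) s
  + cim z * integral_from0 (fr i1) s)).
pose v3 s := (cre (Jmx R i i0) + (cre z * integral_from0 (fr i0) s
  - cim z * integral_from0 (fi i0) s)).
pose v4 s := (cim (Jmx R i i0) + (cre z * integral_from0 (fi i0) s
  + cim z * integral_from0 (fr i0) s)).
have e1 s : 0 <= s -> re_entry W i i0 s = v1 s.
  by move=> /W0 E; rewrite /re_entry E creN creD creM.
have e2 s : 0 <= s -> im_entry W i i0 s = v2 s.
  by move=> /W0 E; rewrite /im_entry E cimN cimD cimM.
have e3 s : 0 <= s -> re_entry W i i1 s = v3 s.
  by move=> /W1 E; rewrite /re_entry E creD creM.
have e4 s : 0 <= s -> im_entry W i i1 s = v4 s.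
  by move=> /W1 E; rewrite /im_entry E cimD cimM.
(* The formulas [e1] to [e4] hold on the half-line only, which is a neighbourhood of each positive
   point. *)
have near_eq (f g : R -> R) (s : R) : 0 < s -> (forall r, 0 <= r -> f r = g r) ->
    \forall r \near s, g r = f r.
  move=> s0 fg; near=> r; rewrite fg//; apply: ltW.
  by near: r; exact: lt_nbhsr.
have cont (f g : R -> R) : (forall r, 0 <= r -> f r = g r) ->
    continuous_ge0 g -> continuous_ge0 f.
  move=> fg [gc g0]; split=> [s s0|].
    suff : f r @[r --> s] --> g s by rewrite -(fg _ (ltW s0)).
    apply: cvg_trans (gc s s0); apply: near_eq_cvg; exact: near_eq.
  rewrite fg//; apply: cvg_trans g0; apply: near_eq_cvg.
  near=> r; rewrite fg//; near: r; exact: nbhs_right_ge.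
have c1 : continuous_ge0 (re_entry W i i0).
  apply: cont e1 _; apply/continuous_ge0N/continuous_ge0D/continuous_ge0B.
  - exact: continuous_ge0_cst.
  - by apply: continuous_ge0M (cr _); exact: continuous_ge0_cst.
  - by apply: continuous_ge0M (ci _); exact: continuous_ge0_cst.
have c2 : continuous_ge0 (im_entry W i i0).
  apply: cont e2 _; apply/continuous_ge0N/continuous_ge0D/continuous_ge0D.
  - exact: continuous_ge0_cst.
  - by apply: continuous_ge0M (ci _); exact: continuous_ge0_cst.
  - by apply: continuous_ge0M (cr _); exact: continuous_ge0_cst.
have c3 : continuous_ge0 (re_entry W i i1).
  apply: cont e3 _; apply/continuous_ge0D/continuous_ge0B.
  - exact: continuous_ge0_cst.
  - by apply: continuous_ge0M (cr _); exact: continuous_ge0_cst.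
  - by apply: continuous_ge0M (ci _); exact: continuous_ge0_cst.
have c4 : continuous_ge0 (im_entry W i i1).
  apply: cont e4 _; apply/continuous_ge0D/continuous_ge0D.
  - exact: continuous_ge0_cst.
  - by apply: continuous_ge0M (ci _); exact: continuous_ge0_cst.
  - by apply: continuous_ge0M (cr _); exact: continuous_ge0_cst.
split=> // s s0 Hs h.
have frE j r : fr j r = re_entry W i i0 r * H r i0 j + re_entry W i i1 r * H r i1 j.
  exact: cre_mul_complexify.
have fiE j r : fi j r = im_entry W i i0 r * H r i0 j + im_entry W i i1 r * H r i1 j.
  exact: cim_mul_complexify.
(* Near [s] the integrand agrees with the one in which [H] is frozen at [H s], and that one is
   continuous. *)
have locconst (f u v : R -> R) j : continuous_ge0 u -> continuous_ge0 v ->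
    (forall r, f r = u r * H r i0 j + v r * H r i1 j) -> {for s, continuous f}.
  move=> [uc _] [vc _] fE; suff : f r @[r --> s] --> u s * H s i0 j + v s * H s i1 j by rewrite -fE.
  have L : u r * H s i0 j + v r * H s i1 j @[r --> s] -->
      u s * H s i0 j + v s * H s i1 j.
    by apply: cvgD; (apply: cvgM; last exact: cvg_cst); [exact: uc|exact: vc].
  apply: cvg_trans L; apply: near_eq_cvg.
  by move: Hs; apply: filterS => r Hr; rewrite fE Hr.
have dr j : is_derive s 1 (integral_from0 (fr j)) (fr j s).
  apply: (is_derive_integral_from0 s0 (fr_int j)).
  exact: (locconst _ _ _ _ c1 c3 (frE j)).
have di j : is_derive s 1 (integral_from0 (fi j)) (fi j s).
  apply: (is_derive_integral_from0 s0 (fi_int j)).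
  exact: (locconst _ _ _ _ c2 c4 (fiE j)).
split.
- apply: (near_eq_is_derive (near_eq _ _ _ s0 e1)).
  rewrite /h -!frE -!fiE.
  exact: (is_derive1N (is_derive1Dcst _
    (is_derive1B (is_derive1Z _ (dr i1)) (is_derive1Z _ (di i1))))).
- apply: (near_eq_is_derive (near_eq _ _ _ s0 e2)).
  rewrite /h -!frE -!fiE.
  exact: (is_derive1N (is_derive1Dcst _
    (is_derive1D (is_derive1Z _ (di i1)) (is_derive1Z _ (dr i1))))).
- apply: (near_eq_is_derive (near_eq _ _ _ s0 e3)).
  rewrite /h -!frE -!fiE.
  exact: (is_derive1Dcst _ (is_derive1B (is_derive1Z _ (dr i0)) (is_derive1Z _ (di i0)))).
- apply: (near_eq_is_derive (near_eq _ _ _ s0 e4)).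
  rewrite /h -!frE -!fiE.
  exact: (is_derive1Dcst _ (is_derive1D (is_derive1Z _ (di i0)) (is_derive1Z _ (dr i0)))).
Unshelve. all: by end_near. Qed.

End FundamentalSolution.

(** * Stereographic projection *)

Section RiemannSphere.
Variable R : realType.
Implicit Types (x y : R[i]) (a b c : option R[i]).

(** The Cauchy-Schwarz inequality in [R^3]. *)
Lemma dot3_le (B C x1 x2 x3 y1 y2 y3 : R) : 0 <= B -> 0 <= C ->
  x1 ^+ 2 + x2 ^+ 2 + x3 ^+ 2 <= B ^+ 2 -> y1 ^+ 2 + y2 ^+ 2 + y3 ^+ 2 <= C ^+ 2 ->
  x1 * y1 + x2 * y2 + x3 * y3 <= B * C.
Proof.
move=> B0 C0 B2 C2.
have BC0 : 0 <= B * C by rewrite mulr_ge0.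
apply: le_trans (ler_norm _) _.
rewrite -(ger0_norm BC0) -ler_sqr ?nnegrE// !real_normK ?num_real// exprMn.
have s3 (a b c : R) : 0 <= a ^+ 2 + b ^+ 2 + c ^+ 2 by rewrite !addr_ge0 ?sqr_ge0.
apply: le_trans (ler_pM (s3 _ _ _) (s3 _ _ _) B2 C2).
(* Lagrange's identity: the defect is the sum of the squared 2 by 2 minors. *)
rewrite -subr_ge0 (_ : _ - _ = (x1 * y2 - x2 * y1) ^+ 2
  + (x1 * y3 - x3 * y1) ^+ 2 + (x2 * y3 - x3 * y2) ^+ 2) ?s3//; ring.
Qed.

(** The triangle inequality in [R^3]. Lengths enter through their squares, the form in which [chi2E]
    provides them. *)
Lemma norm_triangle3 (A B C x1 x2 x3 y1 y2 y3 : R) : 0 <= B -> 0 <= C ->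
  A ^+ 2 = (x1 + y1) ^+ 2 + (x2 + y2) ^+ 2 + (x3 + y3) ^+ 2 ->
  B ^+ 2 = x1 ^+ 2 + x2 ^+ 2 + x3 ^+ 2 -> C ^+ 2 = y1 ^+ 2 + y2 ^+ 2 + y3 ^+ 2 ->
  A <= B + C.
Proof.
move=> B0 C0 A2 B2 C2.
have dot : x1 * y1 + x2 * y2 + x3 * y3 <= B * C by apply: dot3_le; rewrite ?B2 ?C2.
have [A0|/ltW A0] := leP 0 A; last by rewrite (le_trans A0)// addr_ge0.
rewrite -ler_sqr ?nnegrE ?addr_ge0// (sqrrD B) A2 B2 C2 -subr_ge0.
rewrite (_ : _ - _ = (B * C - (x1 * y1 + x2 * y2 + x3 * y3)) *+ 2); last by ring.
by rewrite mulrn_wge0// subr_ge0.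
Qed.

(** Cartesian coordinates on the unit sphere, with infinity at the north pole [(0, 0, 1)]. *)
Definition st_x a := if a is Some x then 2 * cre x / (1 + cabs x ^+ 2) else 0.
Definition st_y a := if a is Some x then 2 * cim x / (1 + cabs x ^+ 2) else 0.
Definition st_z a := if a is Some x then (cabs x ^+ 2 - 1) / (1 + cabs x ^+ 2) else 1.

Lemma cabs2 x : cabs x ^+ 2 = cre x ^+ 2 + cim x ^+ 2.
Proof. by rewrite sqr_sqrtr// addr_ge0 ?sqr_ge0. Qed.

Lemma cabs2D1_gt0 x : 0 < 1 + cabs x ^+ 2.
Proof. by rewrite ltr_pwDl// sqr_ge0. Qed.

Lemma cabs2D1_neq0 x : 1 + (cre x ^+ 2 + cim x ^+ 2) != 0.
Proof. by rewrite -cabs2 gt_eqF// cabs2D1_gt0. Qed.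

Lemma st_norm a : st_x a ^+ 2 + st_y a ^+ 2 + st_z a ^+ 2 = 1.
Proof.
case: a => [x|]; rewrite /st_x /st_y /st_z; last by ring.
by rewrite cabs2; field; exact: cabs2D1_neq0.
Qed.

Lemma chi_ge0 a b : 0 <= chi a b.
Proof.
by case: a => [x|]; case: b => [y|] //=;
  rewrite ?(divr_ge0, mulr_ge0, sqrtr_ge0).
Qed.

Lemma chiC a b : chi a b = chi b a.
Proof.
case: a => [x|]; case: b => [y|] //=; congr (2 * _ / _); last exact: mulrC.
by rewrite /cabs !creD !cimD !creN !cimN; congr Num.sqrt; ring.
Qed.

Lemma chi2E a b : chi a b ^+ 2 =
  (st_x a - st_x b) ^+ 2 + (st_y a - st_y b) ^+ 2 + (st_z a - st_z b) ^+ 2.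
Proof.
have pos x : 0 <= 1 + (cre x ^+ 2 + cim x ^+ 2) by rewrite -cabs2 ltW// cabs2D1_gt0.
case: a => [x|]; case: b => [y|]; rewrite /chi /st_x /st_y /st_z.
- rewrite expr_div_n !exprMn !cabs2 !sqr_sqrtr// creD cimD creN cimN.
  by field; rewrite !cabs2D1_neq0.
- by rewrite expr_div_n !cabs2 sqr_sqrtr//; field; rewrite cabs2D1_neq0.
- by rewrite expr_div_n !cabs2 sqr_sqrtr//; field; rewrite cabs2D1_neq0.
- by rewrite !subrr expr0n/= !addr0.
Qed.

Lemma chi_triangle b a c : chi a c <= chi a b + chi b c.
Proof.
apply: (@norm_triangle3 _ _ _ (st_x a - st_x b) (st_y a - st_y b) (st_z a - st_z b)
   (st_x b - st_x c) (st_y b - st_y c) (st_z b - st_z c));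
   rewrite ?chi_ge0 ?chi2E//.
by rewrite !addrA !subrK.
Qed.

Lemma st_coord_le (u v w e : R) : 0 <= e -> e ^+ 2 = u ^+ 2 + v ^+ 2 + w ^+ 2 -> `|u| <= e.
Proof.
move=> e0 E; rewrite -(ger0_norm e0) -ler_sqr ?nnegrE// !real_normK ?num_real// E.
by rewrite -addrA lerDl addr_ge0 ?sqr_ge0.
Qed.

Lemma st_x_dist a b : `|st_x a - st_x b| <= chi a b.
Proof. exact: st_coord_le (chi_ge0 a b) (chi2E a b). Qed.

Lemma st_y_dist a b : `|st_y a - st_y b| <= chi a b.
Proof.
apply: (st_coord_le (chi_ge0 a b)); rewrite chi2E; rewrite [X in X + _]addrC; reflexivity.
Qed.

Lemma st_z_dist a b : `|st_z a - st_z b| <= chi a b.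
Proof.
by apply: (st_coord_le (chi_ge0 a b)); rewrite chi2E [in LHS]addrC addrA.
Qed.

(** Infinity has [st_y] equal to 0, so the closed half-plane becomes a closed hemisphere without a
    separate case. *)
Lemma in_closed_CplusE a : in_closed_Cplus a <-> 0 <= st_y a.
Proof.
rewrite /st_y; case: a => [x|] /=; last by rewrite lexx.
by rewrite pmulr_lge0 ?invr_gt0 ?cabs2D1_gt0// pmulr_rge0.
Qed.

(** [Theta] depends only on the modulus and the real part, which is why [st_y] is absent. *)
Lemma Theta_entries a : [/\ Theta a i0 i0 = (1 + st_z a) / 2,
  Theta a i0 i1 = st_x a / 2, Theta a i1 i0 = st_x a / 2 &
  Theta a i1 i1 = (1 - st_z a) / 2].
Proof.
case: a => [x|]; rewrite /Theta /st_x /st_z; last by rewrite !mx2E; split; lra.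
rewrite !mxE /= !cabs2.
by split; field; rewrite ?(addrC _ 1) cabs2D1_neq0.
Qed.

End RiemannSphere.

(** * Perturbation estimate for the Bloch vector *)

Section BlochVector.
Variable R : realType.
Variables (t : nat -> R) (X Z : R -> R) (sg ta m : R) (S D C F : R -> R).
Hypothesis t0 : t n @[n --> \oo] --> (0 : R).
(** Nonnegativity of the Hamiltonian with rows [(1 + Z, X) / 2] and [(X, 1 - Z) / 2], whose
    determinant is [(1 - X^2 - Z^2) / 4]. *)
Hypothesis XZ1 : forall s, X s ^+ 2 + Z s ^+ 2 <= 1.
Hypotheses (sgm : `|sg| <= m) (tam : `|ta| <= m) (ta0 : 0 < ta).
Hypotheses (Sc : continuous_ge0 S) (Dc : continuous_ge0 D)
  (Cc : continuous_ge0 C) (Fc : continuous_ge0 F).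
Hypotheses (S0 : forall s, 0 <= S s)
  (S2 : forall s, S s ^+ 2 = D s ^+ 2 + C s ^+ 2 + F s ^+ 2).
Hypothesis ode : forall s, 0 < s -> (forall k, s != t k) ->
  [/\ is_derive s 1 S (- sg * X s * D s + sg * Z s * C s + ta * F s),
      is_derive s 1 D (- sg * X s * S s - sg * C s - ta * Z s * F s),
      is_derive s 1 C (sg * (D s + Z s * S s) - ta * X s * F s) &
      is_derive s 1 F (ta * (S s + Z s * D s + X s * C s))].

Let D1 s : `|D s| <= S s.
Proof. exact: st_coord_le (S0 s) (S2 s). Qed.

Let C1 s : `|C s| <= S s.
Proof. by apply: (@st_coord_le _ _ (D s) (F s)); rewrite ?S0// S2 (addrC (C s ^+ 2)). Qed.

Let F1 s : `|F s| <= S s.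
Proof.
by apply: (@st_coord_le _ _ (D s) (C s)); rewrite ?S0// S2 addrC addrA.
Qed.

Let sqr_le1 (x : R) : x ^+ 2 <= 1 -> `|x| <= 1.
Proof. by move=> x1; rewrite -ler_sqr ?nnegrE// real_normK ?num_real// expr1n. Qed.

Let X1 s : `|X s| <= 1.
Proof. by apply: sqr_le1; apply: le_trans (XZ1 s); rewrite lerDl sqr_ge0. Qed.

Let Z1 s : `|Z s| <= 1.
Proof. by apply: sqr_le1; apply: le_trans (XZ1 s); rewrite lerDr sqr_ge0. Qed.

Let m0 : 0 <= m. Proof. exact: le_trans (normr_ge0 _) sgm. Qed.

Let prod3 (a b c A B K : R) : `|a| <= A -> `|b| <= B -> `|c| <= K -> - (A * B * K) <= a * b * c.
Proof.
move=> aA bB cK; rewrite lerNl; apply: le_trans (ler_norm _) _.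
by rewrite normrN !normrM !ler_pM// mulr_ge0.
Qed.

(** Gronwall's argument: [S'] is a sum of three terms, each at most [m * S], so [S] times
    [expR (- (3 * m) * s)] does not increase. *)
Lemma bloch_vector_growth b : 0 <= b -> S b <= S 0 * expR (3 * m * b).
Proof.
move=> b0.
have : - (S 0 * expR (- (3 * m) * 0)) <= - (S b * expR (- (3 * m) * b)).
  apply: (@le_null_seq_exceptions _ (fun s => - (S s * expR (- (3 * m) * s))) t) => //.
    apply/continuous_ge0N/continuous_ge0M => //; split=> [s _|].
      apply: (@continuous_comp _ _ _ (fun x => - (3 * m) * x) expR); last exact: continuous_expR.
      by apply: cvgM; [exact: cvg_cst|exact: cvg_id].
    apply: cvg_at_right_filter.
    apply: (@continuous_comp _ _ _ (fun x => - (3 * m) * x) expR); last exact: continuous_expR.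
    by apply: cvgM; [exact: cvg_cst|exact: cvg_id].
  move=> s /andP[s0 _] st; have [dS _ _ _] := ode s0 st.
  have dE : is_derive s 1 (fun s => expR (- (3 * m) * s)) (- (3 * m) * expR (- (3 * m) * s)).
    have dl : is_derive s 1 (fun s => - (3 * m) * s) (- (3 * m)).
      by rewrite -[X in is_derive _ _ _ X]mulr1; apply: is_derive1Z; exact: is_derive_id.
    rewrite [X in is_derive _ _ _ X]mulrC; exact: (is_derive1_comp (is_derive_expR _) dl).
  have := is_derive1N (is_derive1M dS dE); set d := (X in is_derive _ _ _ X).
  move=> dd; exists d => //.
  rewrite (_ : d = expR (- (3 * m) * s) * (m * 1 * S s + m * 1 * S s + m * 1 * S s
     + sg * X s * D s - sg * Z s * C s - ta * 1 * F s)); last by rewrite /d; ring.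
  apply: mulr_ge0; first exact: expR_ge0.
  have := prod3 sgm (X1 s) (D1 s).
  have : - (m * 1 * S s) <= - sg * Z s * C s by apply: prod3; rewrite ?normrN.
  have : - (m * 1 * S s) <= - ta * 1 * F s by apply: prod3; rewrite ?normrN ?normr1.
  by lra.
rewrite mulr0 expR0 mulr1 lerN2 => h.
rewrite -(@ler_pM2r _ (expR (- (3 * m) * b))) ?expR_gt0//.
rewrite -[leRHS]mulrA -expRD (_ : 3 * m * b + _ = 0) ?expR0 ?mulr1//; ring.
Qed.

(** [S + Z * D + X * C] is twice the quadratic form of the Hamiltonian at the row. It is nonnegative
    by Cauchy-Schwarz, as [(Z, X)] has length at most 1 and [(D, C, F)] has length [S]. *)
Lemma bloch_F_nondecreasing a b : 0 <= a -> a <= b -> F a <= F b.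
Proof.
move=> a0 ab; apply: (@le_null_seq_exceptions _ F t) => //.
move=> s /andP[as_ _] st; have s0 : 0 < s by exact: le_lt_trans as_.
have [_ _ _ dF] := ode s0 st; exists (ta * (S s + Z s * D s + X s * C s)) => //.
apply: mulr_ge0; first exact: ltW.
have : - Z s * D s + - X s * C s + 0 * F s <= 1 * S s.
  apply: dot3_le; rewrite ?ler01 ?S0 ?S2//.
  by rewrite !sqrrN expr0n addr0 expr1n addrC.
by lra.
Qed.

Variables (X0 Y0 Z0 : R).
Hypotheses (XYZ : X0 ^+ 2 + Y0 ^+ 2 + Z0 ^+ 2 = 1) (Y00 : 0 <= Y0).

Let G s := S s + Z0 * D s + X0 * C s + Y0 * F s.

Let X01 : `|X0| <= 1.
Proof. by apply: (@st_coord_le _ _ Y0 Z0); rewrite ?ler01// expr1n XYZ. Qed.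
Let Y01 : `|Y0| <= 1.
Proof. by apply: (@st_coord_le _ _ X0 Z0); rewrite ?ler01// expr1n -XYZ (addrC (Y0 ^+ 2)). Qed.
Let Z01 : `|Z0| <= 1.
Proof. by apply: (@st_coord_le _ _ X0 Y0); rewrite ?ler01// expr1n -XYZ addrC addrA. Qed.

Let G0 s : 0 <= G s.
Proof.
have : - Z0 * D s + - X0 * C s + - Y0 * F s <= 1 * S s.
  apply: dot3_le; rewrite ?ler01 ?S0 ?S2//.
  by rewrite !sqrrN expr1n -XYZ; lra.
by rewrite /G; lra.
Qed.

(** If [X = X0] and [Z = Z0], then [G' = ta * Y0 * G], which is nonnegative. The deviation from this
    case adds eight terms, each of absolute value at most [m * e * S]; hence the constant 8. *)
Lemma bloch_G_loss a b e Y : 0 <= e -> 0 <= a -> a <= b ->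
  (forall s, a < s < b -> S s <= Y) ->
  (forall s, a < s < b -> `|X s - X0| <= e /\ `|Z s - Z0| <= e) ->
  G a - 8 * m * e * Y * (b - a) <= G b.
Proof.
move=> e0 a0 ab SY XZ.
suff : G a + 8 * m * e * Y * a <= G b + 8 * m * e * Y * b by lra.
apply: (@le_null_seq_exceptions _ (fun s => G s + 8 * m * e * Y * s) t) => //.
  apply: continuous_ge0D; last first.
    by apply: continuous_ge0M; [exact: continuous_ge0_cst|exact: continuous_ge0_id].
  by rewrite /G; apply: continuous_ge0D; [apply: continuous_ge0D;
    [apply: continuous_ge0D => //|]|]; apply: continuous_ge0M => //; exact: continuous_ge0_cst.
move=> s sab st; have s0 : 0 < s by case/andP: sab => as_ _; exact: le_lt_trans as_.
have [dS dD dC dF] := ode s0 st.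
have := is_derive1D (is_derive1D (is_derive1D (is_derive1D dS
  (is_derive1Z Z0 dD)) (is_derive1Z X0 dC))
  (is_derive1Z Y0 dF)) (is_derive1Z (8 * m * e * Y) (is_derive_id s 1)).
set d := (X in is_derive _ _ _ X).
move=> dd; exists d => //.
have [Xe Ze] := XZ _ sab; have SYs := SY _ sab.
set xi := X s - X0 in Xe; set ze := Z s - Z0 in Ze.
have XE : X s = X0 + xi by rewrite /xi; ring.
have ZE : Z s = Z0 + ze by rewrite /ze; ring.
(* Expansion around [X0], [Z0]. The last summand vanishes because [(X0, Y0, Z0)] is a unit
   vector. *)
rewrite (_ : d = ta * Y0 * G s
   + (- sg * xi * D s + sg * ze * C s + (- sg * xi) * (Z0 * S s) + (- ta * ze) * (Z0 * F s)
   + (sg * ze) * (X0 * S s) + (- ta * xi) * (X0 * F s)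
   + (ta * ze) * (Y0 * D s) + (ta * xi) * (Y0 * C s))
   + 8 * m * e * Y + ta * F s * (1 - (X0 ^+ 2 + Y0 ^+ 2 + Z0 ^+ 2))); last first.
  by rewrite /d XE ZE /G; ring.
rewrite XYZ subrr mulr0 addr0.
have meY : 8 * (m * e * S s) <= 8 * m * e * Y.
  by rewrite !mulrA ler_wpM2l// !mulr_ge0.
have tYG : 0 <= ta * Y0 * G s by rewrite !mulr_ge0// ltW.
have p1 u v : `|u| <= 1 -> `|v| <= S s -> `|u * v| <= S s.
  by move=> u1 vS; rewrite normrM -[leRHS]mul1r ler_pM.
have Sn : `|S s| <= S s by rewrite ger0_norm.
have Nsg : `|- sg| <= m by rewrite normrN.
have Nta : `|- ta| <= m by rewrite normrN.
have := prod3 Nsg Xe (D1 s); have := prod3 sgm Ze (C1 s).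
have := prod3 Nsg Xe (p1 _ _ Z01 Sn); have := prod3 Nta Ze (p1 _ _ Z01 (F1 s)).
have := prod3 sgm Ze (p1 _ _ X01 Sn); have := prod3 Nta Xe (p1 _ _ X01 (F1 s)).
have := prod3 tam Ze (p1 _ _ Y01 (D1 s)); have := prod3 tam Xe (p1 _ _ Y01 (C1 s)).
by lra.
Qed.

(* If [F] is still nonpositive at [T], the total increase of [F] is at most [S 0];
   as [F' = ta * G + error], this forces [G 0] to be small once [ta * T] is large. *)
Lemma bloch_G_small a T e Y : 0 <= e -> 0 <= a -> a <= T -> F T <= 0 ->
  (forall s, 0 < s < T -> S s <= Y) ->
  (forall s, a < s < T -> `|X s - X0| <= e /\ `|Z s - Z0| <= e) ->
  ta * (T - a) * (G 0 - 16 * m * a * Y - 8 * m * e * Y * (T - a) - 2 * e * Y) <= S 0.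
Proof.
move=> e0 a0 aT FT SY XZ.
have m_ge0 := m0.
set M := _ - 2 * e * Y.
have Fneg s : 0 <= s <= T -> F s <= 0.
  by move=> /andP[s0 sT]; apply: le_trans FT; exact: bloch_F_nondecreasing.
(* No closeness is known before [a], but coordinates in [[-1, 1]] differ by at most 2; this trivial
   bound turns 8 into 16. *)
have Ga : G 0 - 16 * m * a * Y <= G a.
  have -> : 16 * m * a * Y = 8 * m * 2 * Y * (a - 0) by ring.
  apply: bloch_G_loss => //.
    by move=> s /andP[s0 sa]; apply: SY; rewrite s0 (lt_le_trans sa).
  move=> s _; split; apply: le_trans (ler_normB _ _) _; rewrite (_ : 2 = 1 + 1)// lerD//.
(* The derivative of [F] is at least [ta * M] on [(a, T)]: the term [- Y0 * F] is nonnegative since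
   [F <= 0] there, and the two deviation terms cost at most [2 * e * Y]. *)
have FE : F a - ta * M * a <= F T - ta * M * T.
  apply: (@le_null_seq_exceptions _ (fun s => F s - ta * M * s) t) => //.
    apply: continuous_ge0B => //; apply: continuous_ge0M; first exact: continuous_ge0_cst.
    exact: continuous_ge0_id.
  move=> s /[dup] sab /andP[as_ sT] st.
  have s0 : 0 < s by exact: le_lt_trans as_.
  have [_ _ _ dF] := ode s0 st.
  have := is_derive1B dF (is_derive1Z (ta * M) (is_derive_id s 1)).
  set d := (X in is_derive _ _ _ X).
  move=> dd; exists d => //.
  have Gs : G a - 8 * m * e * Y * (s - a) <= G s.
    apply: bloch_G_loss => //; first exact: ltW.
      move=> r /andP[ar rs]; apply: SY.
      by rewrite (le_lt_trans a0 ar) (lt_trans rs).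
    by move=> r /andP[ar rs]; apply: XZ; rewrite ar (lt_trans rs).
  have SYs : S s <= Y by apply: SY; rewrite s0.
  have Y_0 : 0 <= Y by exact: le_trans SYs.
  have loss : 8 * m * e * Y * (s - a) <= 8 * m * e * Y * (T - a).
    by rewrite ler_wpM2l ?mulr_ge0// lerB// ltW.
  have [Xe Ze] := XZ _ sab.
  have eS : e * S s <= e * Y by rewrite ler_wpM2l.
  have N1 : `|1 : R| <= 1 by rewrite normr1.
  have := prod3 Ze (D1 s) N1; have := prod3 Xe (C1 s) N1; rewrite !mulr1 => hX hZ.
  have YF : Y0 * F s <= 0 by rewrite mulr_ge0_le0// Fneg// !ltW.
  rewrite (_ : d = ta * (G s - Y0 * F s + (Z s - Z0) * D s + (X s - X0) * C s - M)); last first.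
    by rewrite /d /G; ring.
  apply: mulr_ge0; first exact: ltW.
  by rewrite /M; lra.
have Fa : - S 0 <= F a.
  apply: le_trans (bloch_F_nondecreasing (lexx 0) a0).
  by have := F1 0; rewrite ler_norml => /andP[].
by lra.
Qed.

End BlochVector.

(** * Bloch vector of a row *)

Section BlochOfRow.
Variable R : realType.
Local Open Scope complex_scope.

(** Complex linearity of the equation, in real coordinates, for the coefficients [a1 + i a2] and
    [b1 + i b2]. *)
Lemma row_solution_lin (H : R -> 'M[R]_2) sg ta (a1 a2 b1 b2 : R) u1 u2 u3 u4 v1 v2 v3 v4 :
  row_solution H sg ta u1 u2 u3 u4 -> row_solution H sg ta v1 v2 v3 v4 ->
  row_solution H sg ta
    (fun s => (a1 * u1 s - a2 * u2 s) + (b1 * v1 s - b2 * v2 s))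
    (fun s => (a1 * u2 s + a2 * u1 s) + (b1 * v2 s + b2 * v1 s))
    (fun s => (a1 * u3 s - a2 * u4 s) + (b1 * v3 s - b2 * v4 s))
    (fun s => (a1 * u4 s + a2 * u3 s) + (b1 * v4 s + b2 * v3 s)).
Proof.
move=> [cu1 cu2 cu3 cu4 du] [cv1 cv2 cv3 cv4 dv].
have cZ (c : R) f : continuous_ge0 f -> continuous_ge0 (fun s => c * f s).
  by apply: continuous_ge0M; exact: continuous_ge0_cst.
split.
- by apply: continuous_ge0D; apply: continuous_ge0B; exact: cZ.
- by apply: continuous_ge0D; apply: continuous_ge0D; exact: cZ.
- by apply: continuous_ge0D; apply: continuous_ge0B; exact: cZ.
- by apply: continuous_ge0D; apply: continuous_ge0D; exact: cZ.
move=> s s0 Hs h.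
have [du1 du2 du3 du4] := du s s0 Hs; have [dv1 dv2 dv3 dv4] := dv s s0 Hs.
split.
- have := is_derive1D (is_derive1B (is_derive1Z a1 du1) (is_derive1Z a2 du2))
                     (is_derive1B (is_derive1Z b1 dv1) (is_derive1Z b2 dv2)).
  by congr is_derive; rewrite /h; ring.
- have := is_derive1D (is_derive1D (is_derive1Z a1 du2) (is_derive1Z a2 du1))
                     (is_derive1D (is_derive1Z b1 dv2) (is_derive1Z b2 dv1)).
  by congr is_derive; rewrite /h; ring.
- have := is_derive1D (is_derive1B (is_derive1Z a1 du3) (is_derive1Z a2 du4))
                     (is_derive1B (is_derive1Z b1 dv3) (is_derive1Z b2 dv4)).
  by congr is_derive; rewrite /h; ring.
- have := is_derive1D (is_derive1D (is_derive1Z a1 du4) (is_derive1Z a2 du3))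
                     (is_derive1D (is_derive1Z b1 dv4) (is_derive1Z b2 dv3)).
  by congr is_derive; rewrite /h; ring.
Qed.

(** Squares are written as products so that the derivatives come directly from [is_derive1M]. *)
Definition bloch_s (u1 u2 u3 u4 : R -> R) s :=
  (u1 s * u1 s + u2 s * u2 s) + (u3 s * u3 s + u4 s * u4 s).
Definition bloch_d (u1 u2 u3 u4 : R -> R) s :=
  (u1 s * u1 s + u2 s * u2 s) - (u3 s * u3 s + u4 s * u4 s).
Definition bloch_c (u1 u2 u3 u4 : R -> R) s := 2 * (u1 s * u3 s + u2 s * u4 s).
Definition bloch_f (u1 u2 u3 u4 : R -> R) s := 2 * (u4 s * u1 s - u3 s * u2 s).

Section OneRow.
Variables (H : R -> 'M[R]_2) (sg ta : R) (u1 u2 u3 u4 : R -> R).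
Hypothesis u_sol : row_solution H sg ta u1 u2 u3 u4.

Lemma continuous_ge0_bloch :
  [/\ continuous_ge0 (bloch_s u1 u2 u3 u4), continuous_ge0 (bloch_d u1 u2 u3 u4),
      continuous_ge0 (bloch_c u1 u2 u3 u4) & continuous_ge0 (bloch_f u1 u2 u3 u4)].
Proof.
have [c1 c2 c3 c4 _] := u_sol; have c0 := continuous_ge0_cst (2 : R).
split.
- by apply: continuous_ge0D; apply: continuous_ge0D; exact: continuous_ge0M.
- by apply: continuous_ge0B; apply: continuous_ge0D; exact: continuous_ge0M.
- by apply: continuous_ge0M => //; apply: continuous_ge0D; exact: continuous_ge0M.
- by apply: continuous_ge0M => //; apply: continuous_ge0B; exact: continuous_ge0M.
Qed.

Lemma bloch_s_ge0 s : 0 <= bloch_s u1 u2 u3 u4 s.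
Proof. by rewrite /bloch_s -!expr2 !addr_ge0 ?sqr_ge0. Qed.

Lemma bloch_s_sqr s : bloch_s u1 u2 u3 u4 s ^+ 2 =
  bloch_d u1 u2 u3 u4 s ^+ 2 + bloch_c u1 u2 u3 u4 s ^+ 2 + bloch_f u1 u2 u3 u4 s ^+ 2.
Proof. rewrite /bloch_s /bloch_d /bloch_c /bloch_f; ring. Qed.

Lemma bloch_ode (s X Z : R) : 0 < s -> (\forall r \near s, H r = H s) ->
  H s i0 i0 = (1 + Z) / 2 -> H s i0 i1 = X / 2 -> H s i1 i0 = X / 2 ->
  H s i1 i1 = (1 - Z) / 2 ->
  let S := bloch_s u1 u2 u3 u4 in let D := bloch_d u1 u2 u3 u4 in
  let C := bloch_c u1 u2 u3 u4 in let F := bloch_f u1 u2 u3 u4 in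
  [/\ is_derive s 1 S (- sg * X * D s + sg * Z * C s + ta * F s),
      is_derive s 1 D (- sg * X * S s - sg * C s - ta * Z * F s),
      is_derive s 1 C (sg * (D s + Z * S s) - ta * X * F s) &
      is_derive s 1 F (ta * (S s + Z * D s + X * C s))].
Proof.
move=> s0 Hs E00 E01 E10 E11 S D C F.
have [_ _ _ _ /(_ s s0 Hs)] := u_sol; rewrite /= E00 E01 E10 E11 => -[d1 d2 d3 d4].
split.
- have := is_derive1D (is_derive1D (is_derive1M d1 d1) (is_derive1M d2 d2))
                      (is_derive1D (is_derive1M d3 d3) (is_derive1M d4 d4)).
  by congr is_derive; rewrite /D /C /F /bloch_d /bloch_c /bloch_f; field.
- have := is_derive1B (is_derive1D (is_derive1M d1 d1) (is_derive1M d2 d2))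
                      (is_derive1D (is_derive1M d3 d3) (is_derive1M d4 d4)).
  by congr is_derive; rewrite /S /C /F /bloch_s /bloch_c /bloch_f; field.
- have := is_derive1Z 2 (is_derive1D (is_derive1M d1 d3) (is_derive1M d2 d4)).
  by congr is_derive; rewrite /S /D /F /bloch_s /bloch_d /bloch_f; field.
- have := is_derive1Z 2 (is_derive1B (is_derive1M d4 d1) (is_derive1M d3 d2)).
  by congr is_derive; rewrite /S /D /C /bloch_s /bloch_d /bloch_c; field.
Qed.

End OneRow.

Lemma complex_eq0 (x : R[i]) : (x == 0) = (cre x ^+ 2 + cim x ^+ 2 == 0).
Proof.
rewrite paddr_eq0 ?sqr_ge0// !sqrf_eq0; case: x => a b /=.
by rewrite eq_complex.
Qed.

Lemma cre_cim_div (x y : R[i]) : y != 0 ->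
  cre (x / y) = (cre x * cre y + cim x * cim y) / (cre y ^+ 2 + cim y ^+ 2) /\
  cim (x / y) = (cim x * cre y - cre x * cim y) / (cre y ^+ 2 + cim y ^+ 2).
Proof.
case: x => a b; case: y => c d; rewrite complex_eq0 /= => n0.
by split; field.
Qed.

(** In homogeneous coordinates the projection is quadratic; multiplying by [N] covers the point at
    infinity by the same formulas. *)
Lemma st_sph_ratio (x y : R[i]) : let N := cre x ^+ 2 + cim x ^+ 2 + (cre y ^+ 2 + cim y ^+ 2) in
  N != 0 ->
  [/\ N * st_x (sph_ratio x y) = 2 * (cre x * cre y + cim x * cim y),
      N * st_y (sph_ratio x y) = 2 * (cim x * cre y - cre x * cim y) &
      N * st_z (sph_ratio x y) = cre x ^+ 2 + cim x ^+ 2 - (cre y ^+ 2 + cim y ^+ 2)].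
Proof.
rewrite /sph_ratio; case: ifPn => [/eqP -> /= _|y0 /= N0].
  by split; ring.
have [Ere Eim] := cre_cim_div x y0.
rewrite !cabs2 Ere Eim; move: y0; rewrite complex_eq0 => y0.
set k := 1 + _.
have -> : k = (cre x ^+ 2 + cim x ^+ 2 + (cre y ^+ 2 + cim y ^+ 2)) / (cre y ^+ 2 + cim y ^+ 2).
  by rewrite /k; field.
by split; field; rewrite y0 N0.
Qed.

End BlochOfRow.

(** * The estimate on one window *)

Section Window.
Variables (R : realType) (t : nat -> R) (zeta : nat -> option R[i])
  (H : R -> 'M[R]_2).
Hypotheses (t_0 : t 0%N = 1) (t_gt0 : forall n, 0 < t n)
  (t_lim : t n @[n --> \oo] --> (0 : R)).
Hypothesis zeta_Cplus : forall n, in_closed_Cplus (zeta n).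
Hypothesis H_zeta : forall n s, t n.+1 < s <= t n -> H s = Theta (zeta n).
Hypothesis H_tail : forall s, 1 < s -> H s = Theta (Some 0).

(** The least index with [t n < s] is not 0, as [t 0 = 1]; its predecessor is the witness. *)
Lemma window_exists s : 0 < s -> s <= 1 -> exists n, t n.+1 < s <= t n.
Proof.
move=> s0 s1.
have [N _ tN] : \forall k \near \oo, t k < s by exact: (cvgr_lt _ t_lim).
have ex : exists n, t n < s by exists N; apply: tN => /=.
case: (ex_minnP ex) => [[|n] tn nmin]; first by move: tn; rewrite t_0 ltNge s1.
exists n; rewrite tn leNgt; apply/negP => /nmin; by rewrite ltnn.
Qed.

Lemma H_locally_constant s : 0 < s -> (forall k, s != t k) ->
  \forall r \near s, H r = H s.
Proof.
move=> s0 st; have [s1|s1] := leP s 1; last first.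
  near=> r; rewrite !H_tail//; near: r; exact: lt_nbhsr.
have [n /andP[sn /[dup] sn' ns]] := window_exists s0 s1.
have {ns sn'} sn' : s < t n by rewrite lt_neqAle st.
have lt1 : \forall r \near s, t n.+1 < r by exact: lt_nbhsr.
have lt2 : \forall r \near s, r < t n by exact: lt_nbhsl.
near=> r; rewrite (@H_zeta n r) ?(@H_zeta n s) ?sn ?(ltW sn')//.
apply/andP; split; last apply: ltW; near: r; [exact: lt1|exact: lt2].
Unshelve. all: by end_near. Qed.

Lemma H_Theta s : 0 < s -> exists a, H s = Theta a.
Proof.
move=> s0; have [/(window_exists s0)[n /H_zeta ->]|/H_tail ->] := leP s 1.
  by exists (zeta n).
by exists (Some 0).
Qed.

(** The value 0 for [s <= 0], where [H] is arbitrary, makes [ham_xz_le1] hold on the whole line. *)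
Definition ham_x s := if 0 < s then 2 * H s i0 i1 else 0.
Definition ham_z s := if 0 < s then H s i0 i0 - H s i1 i1 else 0.

Lemma ham_xE s a : 0 < s -> H s = Theta a -> ham_x s = st_x a.
Proof.
by move=> s0 Hs; rewrite /ham_x s0 Hs; have [_ -> _ _] := Theta_entries a; field.
Qed.

Lemma ham_zE s a : 0 < s -> H s = Theta a -> ham_z s = st_z a.
Proof.
by move=> s0 Hs; rewrite /ham_z s0 Hs; have [-> _ _ ->] := Theta_entries a; field.
Qed.

Lemma ham_xz_le1 s : ham_x s ^+ 2 + ham_z s ^+ 2 <= 1.
Proof.
have [s0|s0] := ltP 0 s; last by rewrite /ham_x /ham_z ltNge s0 /= expr0n addr0 ler01.
have [a Ha] := H_Theta s0; rewrite (ham_xE s0 Ha) (ham_zE s0 Ha) -(st_norm a).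
by rewrite addrAC lerDl sqr_ge0.
Qed.

Variables (z : R[i]) (W : R -> 'M[R[i]]_2).
Hypotheses (z_gt0 : 0 < cim z) (W_sol : is_fund_sol H z W).

(** Together with [row_im]: entry [j] of the row [(v1, v2) W(s)]. *)
Definition row_re v1 v2 j s := (cre v1 * re_entry W i0 j s - cim v1 * im_entry W i0 j s)
   + (cre v2 * re_entry W i1 j s - cim v2 * im_entry W i1 j s).
Definition row_im v1 v2 j s := (cre v1 * im_entry W i0 j s + cim v1 * re_entry W i0 j s)
   + (cre v2 * im_entry W i1 j s + cim v2 * re_entry W i1 j s).

Lemma row_combination v1 v2 : row_solution H (cre z) (cim z)
  (row_re v1 v2 i0) (row_im v1 v2 i0) (row_re v1 v2 i1) (row_im v1 v2 i1).
Proof. by apply: row_solution_lin; exact: fund_sol_row W_sol. Qed.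

Lemma row_re0 v1 v2 j : row_re v1 v2 j 0 = if j == i0 then cre v1 else cre v2.
Proof.
have [W0 _] := W_sol; rewrite /row_re /re_entry /im_entry W0 !mxE.
have [->|jN] := eqVneq j i0; first by rewrite /=; ring.
have -> : j = i1 by move: jN; case: j => -[|[|k]] // jk _; exact/val_inj.
by rewrite /=; ring.
Qed.

Lemma row_im0 v1 v2 j : row_im v1 v2 j 0 = if j == i0 then cim v1 else cim v2.
Proof.
have [W0 _] := W_sol; rewrite /row_im /re_entry /im_entry W0 !mxE.
have [->|jN] := eqVneq j i0; first by rewrite /=; ring.
have -> : j = i1 by move: jN; case: j => -[|[|k]] // jk _; exact/val_inj.
by rewrite /=; ring.
Qed.

Section Row.
Variables v1 v2 : R[i].
Notation blochOf B := (B (row_re v1 v2 i0) (row_im v1 v2 i0) (row_re v1 v2 i1) (row_im v1 v2 i1)).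
Notation S := (blochOf (@bloch_s R)).
Notation D := (blochOf (@bloch_d R)).
Notation C := (blochOf (@bloch_c R)).
Notation F := (blochOf (@bloch_f R)).

Lemma row_ode s : 0 < s -> (forall k, s != t k) ->
  [/\ is_derive s 1 S (- cre z * ham_x s * D s + cre z * ham_z s * C s + cim z * F s),
      is_derive s 1 D (- cre z * ham_x s * S s - cre z * C s - cim z * ham_z s * F s),
      is_derive s 1 C (cre z * (D s + ham_z s * S s) - cim z * ham_x s * F s) &
      is_derive s 1 F (cim z * (S s + ham_z s * D s + ham_x s * C s))].
Proof.
move=> s0 st; have [a Ha] := H_Theta s0; have [E00 E01 E10 E11] := Theta_entries a.
rewrite (ham_xE s0 Ha) (ham_zE s0 Ha).
apply: (bloch_ode (row_combination v1 v2) s0 (H_locally_constant s0 st)); by rewrite Ha.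
Qed.

Lemma row_F_nondecreasing a b : 0 <= a -> a <= b -> F a <= F b.
Proof.
have [Sc Dc Cc Fc] := continuous_ge0_bloch (row_combination v1 v2).
have S_ge0 := bloch_s_ge0 (row_re v1 v2 i0) (row_im v1 v2 i0) (row_re v1 v2 i1) (row_im v1 v2 i1).
have S_sqr := bloch_s_sqr (row_re v1 v2 i0) (row_im v1 v2 i0) (row_re v1 v2 i1) (row_im v1 v2 i1).
exact: (bloch_F_nondecreasing t_lim ham_xz_le1 z_gt0 Fc S_ge0 S_sqr row_ode).
Qed.

End Row.

Lemma cabs_ge_re : `|cre z| <= cabs z.
Proof. by rewrite -sqrtr_sqr ler_wsqrtr// lerDl sqr_ge0. Qed.

Lemma cabs_ge_im : `|cim z| <= cabs z.
Proof. by rewrite -sqrtr_sqr ler_wsqrtr// lerDr sqr_ge0. Qed.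

(* A vanishing second column would make [F] vanish at [s] for the row starting at [(1, i)],
   whose [F] is nondecreasing and starts at [2]. *)
Lemma second_column_neq0 s : 0 <= s ->
  cre (W s i0 i1) ^+ 2 + cim (W s i0 i1) ^+ 2
  + (cre (W s i1 i1) ^+ 2 + cim (W s i1 i1) ^+ 2) != 0.
Proof.
move=> s0; apply/negP; rewrite paddr_eq0 ?addr_ge0 ?sqr_ge0//.
rewrite !paddr_eq0 ?sqr_ge0// !sqrf_eq0.
move=> /andP[/andP[/eqP a0 /eqP b0] /andP[/eqP c0 /eqP d0]].
have := @row_F_nondecreasing 1%C 'i%C 0 s (lexx 0) s0.
rewrite /bloch_f !row_re0 !row_im0 /row_re /row_im /re_entry /im_entry a0 b0 c0 d0 /=.
by lra.
Qed.

(* The row starting at [(w22 s, - w12 s)] has [F s = 0], and its Bloch vector at [0] is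
   antipodal to the stereographic image of [w12 s / w22 s]. *)
Lemma window_estimate n s kappa L e rho : let m := cabs z in
  0 < kappa -> kappa * m <= cim z -> 1 <= L -> 0 <= e -> 0 <= rho <= 1 / 2 ->
  t n.+2 < m^-1 -> m^-1 <= t n.+1 -> L * t n.+1 <= t n -> t n.+3 <= rho * t n.+2 ->
  chi (zeta n.+2) (zeta n.+1) <= e -> chi (zeta n.+1) (zeta n) <= e -> L / m <= s ->
  chi (sph_ratio (W s i0 i1) (W s i1 i1)) (zeta n.+1) ^+ 2 <=
  2 * expR (3 * L) * (16 * rho + 8 * e * L + 2 * e) + 4 / (kappa * L).
Proof.
move=> m k0 km L1 e0 /andP[rho0 rho1] mlo mhi Ln rhon en en' Ls.
have m0 : 0 < m.
  by apply: lt_le_trans cabs_ge_im; rewrite gtr0_norm.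
have L0 : 0 < L by exact: lt_le_trans L1.
(* The window is [(a, T)]: before [a] the solution hardly moves, as [m * a <= rho], while
   [m * T = L] is large. *)
pose T := L / m; pose a := t n.+3.
have T0 : 0 < T by rewrite divr_gt0.
have s0 : 0 <= s by apply: le_trans Ls; exact: ltW.
have ma : m * a <= rho.
  apply: (@le_trans _ _ (m * (rho * m^-1))).
    rewrite ler_pM2l// (le_trans rhon)// ler_wpM2l//; exact: ltW.
  by rewrite mulrCA divff ?mulr1// gt_eqF.
have mT : m * T = L by rewrite /T mulrCA divff ?mulr1// gt_eqF.
have aT : a <= T by rewrite -(ler_pM2l m0) mT; lra.
have a0 : 0 <= a by exact: ltW (t_gt0 _).
have Tn : T <= t n by apply: le_trans Ln; rewrite /T ler_pM2l.
(* This row annihilates the second column of [W s]. *)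
pose v1 := W s i1 i1; pose v2 := - W s i0 i1.
pose S := bloch_s (row_re v1 v2 i0) (row_im v1 v2 i0) (row_re v1 v2 i1) (row_im v1 v2 i1).
pose D := bloch_d (row_re v1 v2 i0) (row_im v1 v2 i0) (row_re v1 v2 i1) (row_im v1 v2 i1).
pose C := bloch_c (row_re v1 v2 i0) (row_im v1 v2 i0) (row_re v1 v2 i1) (row_im v1 v2 i1).
pose F := bloch_f (row_re v1 v2 i0) (row_im v1 v2 i0) (row_re v1 v2 i1) (row_im v1 v2 i1).
have [Sc Dc Cc Fc] := continuous_ge0_bloch (row_combination v1 v2).
have S_ge0 : forall r, 0 <= S r by move=> r; exact: bloch_s_ge0.
have S_sqr : forall r, S r ^+ 2 = D r ^+ 2 + C r ^+ 2 + F r ^+ 2 by move=> r; exact: bloch_s_sqr.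
have Fs : F s = 0.
  rewrite /F /bloch_f /row_re /row_im /re_entry /im_entry /v1 /v2 creN cimN.
  by ring.
have FT : F T <= 0 by rewrite -Fs; apply: row_F_nondecreasing => //; exact: ltW.
set E := expR (3 * L); set w := sph_ratio _ _; set zn := zeta n.+1.
have SY r : 0 < r < T -> S r <= S 0 * E.
  move=> /andP[r0 rT].
  have := bloch_vector_growth t_lim ham_xz_le1 cabs_ge_re cabs_ge_im Sc S_ge0 S_sqr
    (@row_ode v1 v2) (ltW r0).
  move=> /le_trans; apply; rewrite ler_wpM2l ?S_ge0// ler_expR -mulrA ler_pM2l//.
  by rewrite -mT ler_pM2l// ltW.
(* As [T <= t n], the window meets only the intervals with parameters [zeta n.+2], [zeta n.+1] and
   [zeta n]. *)
have XZ r : a < r < T -> `|ham_x r - st_x zn| <= e /\ `|ham_z r - st_z zn| <= e.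
  move=> /andP[ar rT]; have r0 : 0 < r by exact: le_lt_trans ar.
  suff [b Hb bn] : exists2 b, H r = Theta b & chi b zn <= e.
    rewrite (ham_xE r0 Hb) (ham_zE r0 Hb).
    by split; apply: le_trans bn; [exact: st_x_dist|exact: st_z_dist].
  have [rn2|rn2] := leP r (t n.+2).
    by exists (zeta n.+2) => //; apply: H_zeta; rewrite ar rn2.
  have [rn1|rn1] := leP r (t n.+1).
    exists zn; first by apply: H_zeta; rewrite rn2 rn1.
    apply: le_trans e0; rewrite -(@ler_pXn2r _ 2)// ?nnegrE ?chi_ge0//.
    by rewrite chi2E !subrr expr0n /= !addr0.
  exists (zeta n); first by apply: H_zeta; rewrite rn1 (le_trans (ltW rT)).
  by rewrite chiC.
have XYZ := st_norm zn.
have Y00 : 0 <= st_y zn by apply/in_closed_CplusE; exact: zeta_Cplus.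
have := bloch_G_small t_lim ham_xz_le1 cabs_ge_re cabs_ge_im z_gt0 Sc Dc Cc Fc
  S_ge0 S_sqr (@row_ode v1 v2) XYZ Y00 e0 a0 aT FT SY XZ.
have N0 := second_column_neq0 s0.
have [stx sty stz] := st_sph_ratio N0.
have S0E : S 0 = cre (W s i0 i1) ^+ 2 + cim (W s i0 i1) ^+ 2
  + (cre (W s i1 i1) ^+ 2 + cim (W s i1 i1) ^+ 2).
  by rewrite /S /bloch_s !row_re0 !row_im0 /v1 /v2 /= creN cimN; ring.
rewrite -S0E in stx sty stz N0.
have S00 : 0 < S 0 by rewrite lt_neqAle eq_sym N0 S_ge0.
(* By antipodality the left side is [S 0] times 1 minus the inner product of two unit vectors, that
   is, half their squared distance. *)
have G0E : S 0 + st_z zn * D 0 + st_x zn * C 0 + st_y zn * F 0 = S 0 * (chi w zn ^+ 2 / 2).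
  have -> : D 0 = - (S 0 * st_z w).
    by rewrite stz /D /bloch_d !row_re0 !row_im0 /v1 /v2 /= creN cimN; ring.
  have -> : C 0 = - (S 0 * st_x w).
    by rewrite stx /C /bloch_c !row_re0 !row_im0 /v1 /v2 /= creN cimN; ring.
  have -> : F 0 = - (S 0 * st_y w).
    by rewrite sty /F /bloch_f !row_re0 !row_im0 /v1 /v2 /= creN cimN; ring.
  have nw := st_norm w; have nz := st_norm zn.
  apply/eqP; rewrite -subr_eq0; apply/eqP.
  transitivity (S 0 / 2 * ((1 - (st_x w ^+ 2 + st_y w ^+ 2 + st_z w ^+ 2))
    + (1 - (st_x zn ^+ 2 + st_y zn ^+ 2 + st_z zn ^+ 2)))); first by rewrite chi2E; field.
  by rewrite nw nz !subrr addr0 mulr0.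
rewrite -/S -/D -/C -/F G0E.
set Q := chi w zn ^+ 2; set B := E * (16 * rho + 8 * e * L + 2 * e).
have E0 : 0 < E by exact: expR_gt0.
have B0 : 0 <= B.
  by rewrite /B mulr_ge0 ?(ltW E0)// !addr_ge0// !mulr_ge0// ltW.
have kL : 0 < kappa * L by rewrite mulr_gt0.
rewrite (_ : 2 * E * _ = 2 * B); last by rewrite /B; ring.
(* In the first case the error term alone gives the claim; in the second [Q / 2 - B] is positive, so
   lower bounds may be multiplied. *)
have [QB|QB] := leP (Q / 2) B.
  move=> _; have : 0 <= 4 / (kappa * L) by rewrite divr_ge0// ltW.
  by lra.
set K := _ * (T - a) * _ => hK.
(* [cim z * (T - a)] is at least [kappa * (L - rho)], and [rho <= 1 / 2 <= L / 2]. *)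
have : kappa * L / 2 * (S 0 * (Q / 2 - B)) <= S 0.
  apply: le_trans hK; apply: ler_pM.
  - by rewrite divr_ge0// ltW.
  - by rewrite mulr_ge0// subr_ge0 ltW.
  - apply: (@le_trans _ _ (kappa * m * (T - a))).
      rewrite -!mulrA ler_pM2l// mulrBr mT; lra.
    by rewrite ler_wpM2r// subr_ge0.
  have maE : 16 * m * a * (S 0 * E) <= 16 * rho * (S 0 * E).
    rewrite -!mulrA [leRHS]mulrA [X in X <= _](_ : _ = 16 * (m * a) * (S 0 * E)); last by ring.
    by rewrite ler_wpM2r ?mulr_ge0 ?S_ge0 ?(ltW E0)// ler_pM2l.
  have mTa : 8 * m * e * (S 0 * E) * (T - a) <= 8 * e * L * (S 0 * E).
    rewrite (_ : 8 * m * e * _ * _ = 8 * e * (m * (T - a)) * (S 0 * E)); last by ring.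
    rewrite ler_wpM2r ?mulr_ge0 ?S_ge0 ?(ltW E0)// ler_wpM2l ?mulr_ge0//.
    by rewrite mulrBr mT gerBl mulr_ge0// ltW.
  by rewrite -/m /B; lra.
move=> h; have {h} : kappa * L / 2 * (Q / 2 - B) <= 1.
  by rewrite -(ler_pM2l S00) mulr1 mulrCA.
by rewrite -lerBlDl ler_pdivlMr//; lra.
Qed.

End Window.

(** * Cluster sets *)

Section ClusterSets.
Variable R : realType.

Lemma cvg0_ge0P (u : nat -> R) : (forall n, 0 <= u n) ->
  (u n @[n --> \oo] --> (0 : R)) <->
  (forall e, 0 < e -> exists N, forall n, (N <= n)%N -> u n <= e).
Proof.
move=> u0; split=> [/cvgr0Pnorm_le h e /h[N _ hN]|h].
  by exists N => n /hN; rewrite /= ger0_norm.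
apply/cvgr0Pnorm_le => e /h[N hN]; exists N => //= n /hN.
by rewrite ger0_norm.
Qed.

Lemma cvg_pinftyP (u : nat -> R) : (u n @[n --> \oo] --> +oo) <->
  (forall A, exists N, forall n, (N <= n)%N -> A <= u n).
Proof.
split=> [/cvgryPge h A|h].
  by have [N _ hN] := h A; exists N => n /hN.
by apply/cvgryPge => A; have [N hN] := h A; exists N.
Qed.

Lemma sin_gt0_half_pi (alpha : R) : 0 < alpha <= pi / 2 -> 0 < sin alpha.
Proof.
move=> /andP[a0 api]; have pi0 := pi_gt0 R.
by apply: sin_gt0_pi; rewrite a0/=; lra.
Qed.

(** The cosine of the argument lies between [- cos alpha] and [cos alpha], so its sine is at least
    [sin alpha]. *)
Lemma Gamma_sub_cone (alpha : R) (z : R[i]) : 0 < alpha <= pi / 2 ->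
  Gamma alpha z -> sin alpha * cabs z <= cim z.
Proof.
move=> al0 [z0 /andP[az za]].
have sa := ltW (sin_gt0_half_pi al0); move: al0 => /andP[a0 api].
have pi0 : 0 < pi :> R := pi_gt0 R.
have m0 : 0 < cabs z by rewrite sqrtr_gt0 ltr_wpDl ?sqr_ge0// exprn_gt0.
pose x := cre z / cabs z.
have xm : cre z = x * cabs z by rewrite /x divfK// gt_eqF.
have cz := cabs2 z.
have x1 : -1 <= x <= 1.
  rewrite -ler_norml /x normrM normfV (gtr0_norm m0) ler_pdivrMr// mul1r.
  by rewrite -sqrtr_sqr ler_wsqrtr// lerDl sqr_ge0.
have cacos : cos (carg z) = x by rewrite /carg -/x acosK.
have cpi : carg z \in `[0, pi] by rewrite in_itv/= acos_ge0// acos_lepi.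
have xle : x <= cos alpha.
  rewrite leNgt -cacos ltr_cos ?in_itv/= -?leNgt//; by rewrite (ltW a0)/=; lra.
have xge : - cos alpha <= x.
  rewrite -cosN -cosDpi leNgt -cacos ltr_cos ?in_itv/= -?leNgt//; first by rewrite addrC.
  by apply/andP; split; lra.
have x2 : 0 <= (cos alpha - x) * (cos alpha + x) by rewrite mulr_ge0//; lra.
rewrite -ler_sqr ?nnegrE ?mulr_ge0// ?(ltW m0)// ?(ltW z0)//.
have -> : cim z ^+ 2 = (1 - x ^+ 2) * cabs z ^+ 2 by move: cz; rewrite xm; lra.
rewrite exprMn ler_wpM2r ?sqr_ge0// sin2cos2; move: x2; lra.
Qed.

(** The modulus is continuous, so its image of a connected tail of [M] is an interval, and it is
    unbounded. *)
Lemma cond_star_radius (M : set R[i]) : cond_star M ->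
  exists r1, forall r, r1 <= r -> exists2 z, M z & cabs z = r.
Proof.
move=> [Munb [_ [r0 Mconn]]].
have [z0 [Mz0 rz0]] := Munb r0.
exists (cabs z0) => r zr; have [z2 [Mz2 rz2]] := Munb r.
pose A := (@toR2 R) @` [set z | M z /\ r0 <= cabs z].
pose nrm (p : R * R) := Num.sqrt (p.1 ^+ 2 + p.2 ^+ 2).
have nrm_cont : continuous nrm.
  move=> p; apply: (@continuous_comp _ _ _ (fun p : R * R => p.1 ^+ 2 + p.2 ^+ 2) Num.sqrt).
    by apply: cvgD; apply: (@continuous_comp _ _ _ _ (fun x : R => x ^+ 2))
      (@exprn_continuous R 2 _);
      [exact: cvg_fst|exact: cvg_snd].
  exact: sqrt_continuous.
have /connected_intervalP itvA : connected (nrm @` A).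
  apply: connected_continuous_connected; first exact: Mconn.
  exact: continuous_subspaceT.
have img z : M z -> r0 <= cabs z -> (nrm @` A) (cabs z).
  by move=> Mz rz; exists (toR2 z) => //; exists z.
have [|||_ [z [Mz _] <-] <-] := itvA (cabs z0) (cabs z2) _ _ r.
- exact: img Mz0 (ltW rz0).
- by apply: img => //; rewrite ltW// (lt_trans rz0)// (le_lt_trans zr).
- by rewrite zr ltW.
by exists z.
Qed.

End ClusterSets.

(** * Approximation of the Weyl coefficient by [zeta], and the two inclusions between cluster
    sets *)

Section MainEstimate.
Variables (R : realType) (t : nat -> R) (zeta : nat -> option R[i])
  (H : R -> 'M[R]_2) (W : R[i] -> R -> 'M[R[i]]_2) (q : R[i] -> option R[i]).
Hypotheses (t_0 : t 0%N = 1) (t_gt0 : forall n, 0 < t n)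
  (t_decr : forall n, t n.+1 < t n) (t_lim : t n @[n --> \oo] --> (0 : R))
  (t_ratio : (t n.+1 / t n) @[n --> \oo] --> (0 : R)).
Hypothesis zeta_Cplus : forall n, in_closed_Cplus (zeta n).
Hypothesis zeta_slow : chi (zeta n.+1) (zeta n) @[n --> \oo] --> (0 : R).
Hypothesis H_zeta : forall n s, t n.+1 < s <= t n -> H s = Theta (zeta n).
Hypothesis H_tail : forall s, 1 < s -> H s = Theta (Some 0).
Hypothesis W_sol : forall z, 0 < cim z -> is_fund_sol H z (W z).
Hypothesis q_lim : forall z, 0 < cim z ->
  chordal_lim_infty (fun s => sph_ratio (W z s i0 i1) (W z s i1 i1)) (q z).

(** Half of [eps] is spent on the distance from [q z] to the ratio at a late [s], half on
    [window_estimate] for that ratio. *)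
Lemma weyl_window (kappa eps : R) : 0 < kappa -> 0 < eps ->
  exists N, forall n z, (N <= n)%N -> 0 < cim z -> kappa * cabs z <= cim z ->
    t n.+1 < (cabs z)^-1 <= t n -> chi (q z) (zeta n) <= eps.
Proof.
move=> k0 eps0; pose d := eps / 2; have d0 : 0 < d by rewrite divr_gt0.
(* [L] is fixed first, so that [4 / (kappa * L)] is at most [d^2 / 2]. Then [del], which depends on
   [L], makes the exponential term at most [d^2 / 2], with [18 + 8 * L] collecting its three
   coefficients. *)
pose L := 1 + 8 / (kappa * d ^+ 2).
have kd : 0 < kappa * d ^+ 2 by rewrite mulr_gt0// exprn_gt0.
have L1 : 1 <= L by rewrite lerDl divr_ge0// ltW.
have L0 : 0 < L by exact: lt_le_trans L1.
have Lk : 4 / (kappa * L) <= d ^+ 2 / 2.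
  rewrite ler_pdivrMr ?mulr_gt0// /L.
  rewrite (_ : d ^+ 2 / 2 * _ = kappa * d ^+ 2 / 2 +
    4 * (kappa * d ^+ 2 / (kappa * d ^+ 2))); last by field; rewrite !gt_eqF.
  by rewrite divff ?gt_eqF// mulr1 lerDr divr_ge0// ltW.
pose E := expR (3 * L); have E0 : 0 < E by exact: expR_gt0.
have den : 0 < 4 * E * (18 + 8 * L) by rewrite !mulr_gt0// addr_gt0// mulr_gt0.
pose del := Num.min (1 / 2) (d ^+ 2 / (4 * E * (18 + 8 * L))).
have del0 : 0 < del.
  by rewrite lt_min; apply/andP; split; rewrite divr_gt0// exprn_gt0.
have delE : 2 * E * (16 * del + 8 * del * L + 2 * del) <= d ^+ 2 / 2.
  have : del <= d ^+ 2 / (4 * E * (18 + 8 * L)) by rewrite ge_min lexx orbT.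
  by rewrite ler_pdivlMr//; lra.
have ratio_ge0 n : 0 <= t n.+1 / t n by rewrite divr_ge0// ltW.
have r0 : 0 < Num.min del (L^-1) by rewrite lt_min del0 invr_gt0.
have [N1 hN1] := (cvg0_ge0P ratio_ge0).1 t_ratio _ r0.
have [N2 hN2] := (cvg0_ge0P (fun n => chi_ge0 (zeta n.+1) (zeta n))).1 zeta_slow _ del0.
(* The successor excludes index 0: [window_estimate] also needs the interval preceding the one that
   contains [1/|z|]. *)
exists (maxn N1 N2).+1 => -[//|n] z nN z0 kz /andP[zlo zhi].
have /andP[nN1 nN2] : (N1 <= n)%N && (N2 <= n)%N by rewrite -geq_max.
have m0 : 0 < cabs z by rewrite sqrtr_gt0 ltr_wpDl ?sqr_ge0// exprn_gt0.
have [T0 hT0] := q_lim z0 d0.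
pose s := Num.max (T0 + 1) (L / cabs z).
have sT0 : T0 < s by rewrite lt_max ltrDl ltr01.
have Ls : L / cabs z <= s by rewrite le_max lexx orbT.
have Lt : L * t n.+1 <= t n.
  have := hN1 n nN1; rewrite le_min => /andP[_].
  by rewrite ler_pdivrMr// => h; rewrite -ler_pdivlMl.
have rt : t n.+3 <= del * t n.+2.
  have := hN1 n.+2 (leqW (leqW nN1)); rewrite le_min => /andP[+ _].
  by rewrite ler_pdivrMr.
have del1 : 0 <= del <= 1 / 2 by rewrite ltW//= ge_min lexx.
have := window_estimate t_0 t_gt0 t_lim zeta_Cplus H_zeta H_tail z0 (W_sol z0) k0 kz
  L1 (ltW del0) del1 zlo zhi Lt rt (hN2 n.+1 (leqW nN2)) (hN2 n nN2) Ls.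
set w := sph_ratio _ _ => chi2.
have chid : chi w (zeta n.+1) <= d.
  rewrite -ler_sqr ?nnegrE ?chi_ge0 ?(ltW d0)//.
  by apply: (le_trans chi2); move: delE Lk; rewrite /E; lra.
apply: (le_trans (chi_triangle w _ _)); rewrite /d in chid hT0.
by have := hT0 s sT0; rewrite chiC -/w; move: chid; lra.
Qed.

Lemma CL_sub_Clus (kappa : R) (M : set R[i]) l : 0 < kappa ->
  (forall z, M z -> 0 < cim z /\ kappa * cabs z <= cim z) -> CL q M l -> Clus zeta l.
Proof.
move=> k0 Mk [zs [Mzs [/cvg_pinftyP zsy /(cvg0_ge0P (fun n => chi_ge0 _ _)) qzs]]].
(* [nk k] is the index of the interval containing [1/|z_k|]. The finitely many points of modulus
   below 1 get the dummy index 0. *)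
have /choice[nk hnk] : forall k, exists n, 1 <= cabs (zs k) -> t n.+1 < (cabs (zs k))^-1 <= t n.
  move=> k; have [z1|z1] := leP 1 (cabs (zs k)); last by exists 0%N.
  have [||n hn] := window_exists t_0 t_lim (s := (cabs (zs k))^-1).
  - by rewrite invr_gt0; exact: lt_le_trans z1.
  - by rewrite invf_le1//; exact: lt_le_trans z1.
  by exists n.
have t_anti : {homo t : m n / (m <= n)%N >-> n <= m}.
  by apply/nonincreasing_seqP => n; exact: ltW.
(* An index below [N] would give [t N <= t (nk k).+1 < 1/|z_k|], which fails once the modulus is at
   least [1 / t N]. *)
have nkoo N : exists K, forall k, (K <= k)%N -> (N <= nk k)%N /\ 1 <= cabs (zs k).
  have [K hK] := zsy (Num.max 1 (t N)^-1).
  exists K => k /hK; rewrite ge_max => /andP[z1 zN]; split=> //.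
  have /andP[lo _] := hnk k z1; rewrite leqNgt; apply/negP => /t_anti.
  rewrite leNgt => /negP; apply; apply: lt_le_trans lo _.
  rewrite -[leRHS]invrK lef_pV2// posrE ?invr_gt0//; exact: lt_le_trans z1.
have near_l e : 0 < e -> exists N, forall k, (N <= k)%N -> chi (zeta (nk k)) l <= e.
  move=> e0; have e20 : 0 < e / 2 by rewrite divr_gt0.
  have [N hN] := weyl_window k0 e20; have [K1 hK1] := nkoo N; have [K2 hK2] := qzs _ e20.
  exists (maxn K1 K2) => k; rewrite geq_max => /andP[/hK1[Nk z1] /hK2 ql].
  have [z0 kz] := Mk _ (Mzs k).
  have := hN _ _ Nk z0 kz (hnk k z1); rewrite chiC => zq.
  by apply: (le_trans (chi_triangle (q (zs k)) _ _)); lra.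
split; last first.
  exists nk; split; last by apply/cvg0_ge0P => // n; exact: chi_ge0.
  by move=> N; have [K hK] := nkoo N; exists K => k /hK[].
(* The closed hemisphere is closed: a limit with negative [st_y] would force some [zeta (nk N)] to
   have negative [st_y]. *)
apply/in_closed_CplusE; rewrite leNgt; apply/negP => ly.
have [|N /(_ N (leqnn N)) hN] := near_l (- st_y l / 2); first by rewrite divr_gt0// oppr_gt0.
have /in_closed_CplusE zy := zeta_Cplus (nk N).
have := le_trans (st_y_dist (zeta (nk N)) l) hN; rewrite ler_norml => /andP[_]; lra.
Qed.

Lemma Clus_sub_CL (M : set R[i]) l : cond_star M -> Clus zeta l -> CL q M l.
Proof.
move=> Mst [_ [nk [nkoo /(cvg0_ge0P (fun n => chi_ge0 _ _)) zl]]].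
have [r1 hr1] := cond_star_radius Mst.
have [_ [[al [al0 Mal]] _]] := Mst.
have [k0 Mk] : 0 < sin al /\ forall z, M z -> 0 < cim z /\ sin al * cabs z <= cim z.
  split; first exact: sin_gt0_half_pi.
  by move=> z /Mal /[dup] -[? _] /(Gamma_sub_cone al0).
(* The desired modulus is [1 / t (nk k)], but only radii from [r1] on are known to be attained; the
   maximum matters for finitely many [k] only. *)
have /choice[zs hzs] : forall k, exists z, M z /\ cabs z = Num.max r1 (t (nk k))^-1.
  by move=> k; have [|z Mz zE] := hr1 (Num.max r1 (t (nk k))^-1);
    [rewrite le_max lexx|exists z].
have toy A : exists K, forall k, (K <= k)%N -> A <= (t (nk k))^-1.
  pose B := Num.max A 1; have B0 : 0 < B by rewrite lt_max ltr01 orbT.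
  have [N _ hN] : \forall k \near \oo, t k < B^-1.
    by apply: (cvgr_lt _ t_lim); rewrite invr_gt0.
  have [K hK] := nkoo N; exists K => k /hK /hN /= tB.
  apply: (@le_trans _ _ B); first by rewrite le_max lexx.
  by rewrite -[leLHS]invrK lef_pV2 ?posrE ?invr_gt0// ltW.
exists zs; split; first by move=> n; have [] := hzs n.
split.
  apply/cvg_pinftyP => A; have [K hK] := toy A; exists K => k /hK h.
  by have [_ ->] := hzs k; rewrite le_max h orbT.
apply/cvg0_ge0P => [n|e e0]; first exact: chi_ge0.
have e20 : 0 < e / 2 by rewrite divr_gt0.
have [N hN] := weyl_window k0 e20; have [K1 hK1] := nkoo N; have [K2 hK2] := zl _ e20.
have [K3 hK3] := toy r1.
exists (maxn K1 (maxn K2 K3)) => k; rewrite !geq_max => /and3P[/hK1 Nk /hK2 zle /hK3 rk].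
have [Mz zE] := hzs k; have [z0 kz] := Mk _ Mz.
have zt : (cabs (zs k))^-1 = t (nk k) by rewrite zE; move: rk => /max_idPr ->; rewrite invrK.
have := hN _ _ Nk z0 kz; rewrite zt lexx t_decr => /(_ isT) zq.
by apply: (le_trans (chi_triangle (zeta (nk k)) _ _)); lra.
Qed.

End MainEstimate.

Theorem mainTheorem13 (R : realType) (t : nat -> R) (zeta : nat -> option R[i])
  (H : R -> 'M[R]_2) (W : R[i] -> R -> 'M[R[i]]_2) (q : R[i] -> option R[i]) :
  t 0%N = 1 ->
  (forall n, 0 < t n) ->
  (forall n, t n.+1 < t n) ->
  t n @[n --> \oo] --> 0 ->
  (t n.+1 / t n) @[n --> \oo] --> 0 ->
  (forall n, in_closed_Cplus (zeta n)) ->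
  chi (zeta n.+1) (zeta n) @[n --> \oo] --> 0 ->
  (forall n s, t n.+1 < s <= t n -> H s = Theta (zeta n)) ->
  (forall s, 1 < s -> H s = Theta (Some 0)) ->
  (forall z, 0 < cim z -> is_fund_sol H z (W z)) ->
  (forall z, 0 < cim z ->
     chordal_lim_infty (fun s => sph_ratio (W z s i0 i1) (W z s i1 i1)) (q z)) ->
  forall M : set R[i], cond_star M ->
    Ca q = CL q M /\ CL q M = Clus zeta.
Proof.
move=> t_0 t_gt0 t_decr t_lim t_ratio zeta_Cplus zeta_slow H_zeta H_tail W_sol q_lim M Mst.
(* The three inclusions [CaClus], [ClusCL] and [CLCa] close a cycle, which gives both equalities. *)
have CaClus l : Ca q l -> Clus zeta l.
  move=> [al [al0]].
  apply: (CL_sub_Clus t_0 t_gt0 t_decr t_lim t_ratio zeta_Cplus zeta_slow H_zeta H_tail W_sol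
    q_lim (sin_gt0_half_pi al0)).
  by move=> z /[dup] -[? _] /(Gamma_sub_cone al0).
have ClusCL l : Clus zeta l -> CL q M l.
  exact: (Clus_sub_CL t_0 t_gt0 t_decr t_lim t_ratio zeta_Cplus zeta_slow H_zeta H_tail W_sol
    q_lim Mst).
have CLCa l : CL q M l -> Ca q l.
  have [_ [[al [al0 Mal]] _]] := Mst.
  by move=> [zs [Mzs zsl]]; exists al; split=> //; exists zs; split=> // n; exact: Mal.
split; apply/seteqP; split=> l.
- by move=> /CaClus /ClusCL.
- exact: CLCa.
- by move=> /CLCa /CaClus.
- exact: ClusCL.
Qed.
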